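(* Let $n\ge 1$ be an integer, let $a_0,a_1,\ldots,a_n$ be nonnegative integers, and put $a=a_1+a_2+\cdots+a_n$ (so $a_0$ is not included). Let $i_1,\ldots,i_m$ and $j_1,\ldots,j_\nu$ be (altogether) distinct integers satisfying $0=i_1<i_2<\cdots<i_m<n$ and $0<j_1<\cdots<j_\nu\le n$, let $p_1,\ldots,p_\nu$ be positive integers with $\sum_{i=1}^{\nu}p_i=m$, and put $I_0=\{i_1,i_2,\ldots,i_m\}$. Then $$\mathop{\mathrm{CT}}_{\mathbf{x}}\frac{x_{j_1}^{p_1}\cdots x_{j_\nu}^{p_\nu}}{x_{i_1}x_{i_2}\cdots x_{i_m}}\,D_n(\mathbf{x},\mathbf{a},q)=\frac{(q)_{a+a_0}}{(q)_{a_0}(q)_{a_1}\cdots(q)_{a_n}}\sum_{\varnothing\neq T\subseteq I_0}(-1)^{d}q^{L(T)}\frac{1-q^{\sigma(T)}}{1-q^{1+a_0+a-\sigma(T)}},$$ where, for each nonempty subset $T\subseteq I_0$, $d=|T|$, $\sigma(T)=\sum_{t\in T}a_t$, and $$L(T)=\sum_{l\in I_0}\sum_{i=l}^{n}w_i-\sum_{l=1}^{\nu}p_l\sum_{i=j_l}^{n}w_i,$$ with $w_i=0$ if $i\in T$ and $w_i=a_i$ if $i\notin T$ (for $0\le i\le n$).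
   Context: Here $q$ is an indeterminate (one works over $\mathbb{C}(q)$), $\mathbf{x}=(x_0,\ldots,x_n)$, $\mathbf{a}=(a_0,\ldots,a_n)$, and $(z)_k=(1-z)(1-zq)\cdots(1-zq^{k-1})$ for integers $k\ge 0$, so $(q)_k=(1-q)(1-q^2)\cdots(1-q^k)$. The $q$-Dyson product is $$D_n(\mathbf{x},\mathbf{a},q)=\prod_{0\le i<j\le n}\left(\frac{x_i}{x_j}\right)_{a_i}\left(\frac{x_j}{x_i}q\right)_{a_j}.$$ $\mathop{\mathrm{CT}}_{\mathbf{x}}F(\mathbf{x})$ denotes the constant term of $F$ in the variables $x_0,\ldots,x_n$, i.e. the coefficient of $x_0^0x_1^0\cdots x_n^0$. *)

(* Defs.v *)
From HB Require Import structures.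
From Stdlib Require Import ClassicalEpsilon.
From mathcomp Require Import all_boot all_order all_algebra.
From mathcomp Require Import reals complex.
From mathcomp Require Export mpoly.

Set Implicit Arguments.
Unset Strict Implicit.
Unset Printing Implicit Defensive.

Import Order.TTheory GRing.Theory Num.Theory.
Local Open Scope ring_scope.

Notation "x %:Frac" := (@FracField.tofrac _ x)
  (at level 2, left associativity, format "x %:Frac") : ring_scope.

(* The field C(q), with C the complex numbers over a model R of the reals. *)
Notation Cq R := {fraction {poly R[i]}}.

Definition qind (R : realType) : Cq R := ('X : {poly R[i]})%:Frac.

Definition qpoch (A : comNzRingType) (q z : A) (k : nat) : A :=
  \prod_(s < k) (1 - z * q ^+ s).

Definition qfact (A : comNzRingType) (q : A) (k : nat) : A := qpoch q q k.

(* Laurent polynomials in n variables over K are handled inside the field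
   K(x_0, ..., x_(n-1)), as the fractions whose denominator is a monomial. *)
Notation ratfun K n := {fraction {mpoly K[n]}}.

Definition rvar (K : fieldType) (n : nat) (i : 'I_n) : ratfun K n :=
  ('X_i : {mpoly K[n]})%:Frac.

Definition rconst (K : fieldType) (n : nat) (c : K) : ratfun K n :=
  (c%:MP : {mpoly K[n]})%:Frac.

(* If F = P / x^u, the coefficient of x^0 in F is that of x^u in P. *)
Definition is_CT (K : fieldType) (n : nat) (F : ratfun K n) (c : K) : Prop :=
  exists (P : {mpoly K[n]}) (u : 'X_{1..n}),
    F = P%:Frac / ('X_[u] : {mpoly K[n]})%:Frac /\ c = P@_u.

(* Meaningful for Laurent polynomials only (see CT_frac); the value at any
   other rational function is unspecified. *)
Definition CT (K : fieldType) (n : nat) (F : ratfun K n) : K :=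
  epsilon (inhabits 0) (is_CT F).

Definition dyson (K : fieldType) (q : K) (n : nat) (a : 'I_n.+1 -> nat) :
    ratfun K n.+1 :=
  let x := @rvar K n.+1 in
  let Q := rconst n.+1 q in
  \prod_(i < n.+1) \prod_(j < n.+1 | (i < j)%N)
    (qpoch Q (x i / x j) (a i) * qpoch Q (x j / x i * Q) (a j)).

Definition sigma (n : nat) (a : 'I_n.+1 -> nat) (T : {set 'I_n.+1}) : nat :=
  (\sum_(t in T) a t)%N.

Definition wt (n : nat) (a : 'I_n.+1 -> nat) (T : {set 'I_n.+1})
    (r : 'I_n.+1) : nat :=
  if r \in T then 0%N else a r.

(* L(T) may be negative, hence an integer. *)
Definition Lexp (n : nat) (a : 'I_n.+1 -> nat) (nu : nat)
    (j : 'I_nu -> 'I_n.+1) (p : 'I_nu -> nat) (I0 T : {set 'I_n.+1}) : int :=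
  (\sum_(l in I0) \sum_(r < n.+1 | (l <= r)%N) wt a T r)%N%:Z -
  (\sum_(l < nu) p l * \sum_(r < n.+1 | (j l <= r)%N) wt a T r)%N%:Z.

Lemma is_CT_uniq (K : fieldType) (n : nat) (F : ratfun K n) (c d : K) :
  is_CT F c -> is_CT F d -> c = d.
Proof.
move=> [P [u [-> ->]]] [Q [v [eqPQ ->]]].
have nz w : (('X_[w] : {mpoly K[n]})%:Frac) != 0.
  rewrite tofrac_eq0; apply/eqP => /(congr1 (mcoeff w))/eqP.
  by rewrite mcoeffX eqxx mcoeff0 oner_eq0.
move/eqP: eqPQ; rewrite eqr_div // -!tofracM tofrac_eq => /eqP eqPQ.
by rewrite -(mcoeffMX P v u) eqPQ addmC mcoeffMX.
Qed.

Lemma CT_frac (K : fieldType) (n : nat) (P : {mpoly K[n]}) (u : 'X_{1..n}) :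
  CT (P%:Frac / ('X_[u] : {mpoly K[n]})%:Frac) = P@_u.
Proof.
have isP : is_CT (P%:Frac / ('X_[u] : {mpoly K[n]})%:Frac) P@_u.
  by exists P, u.
by apply: (is_CT_uniq _ isP); apply: (epsilon_spec _ (is_CT _)); exists P@_u.
Qed.

(* Main.v *)
From HB Require Import structures.
Require Import Defs.
From mathcomp Require Import all_boot all_order all_algebra.
From mathcomp Require Import reals complex ssrcomplements ring zify.

(** The idea is to read the constant term as a function of z = q^(a_0), the other
    exponents being fixed. Put a = a_1 + ... + a_n and let D_S be the Dyson
    product restricted to the variables in S. Constant terms are coefficients of
    the numerator dysonp of D, at the monomial that clears the denominators.

    Set x_0 = 1, which is harmless by homogeneity, and expand the factors of D
    containing x_0 by the q-binomial theorem: the constant term becomes a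
    polynomial in z of degree at most a + 1 (elimination, elim_poly). It is
    therefore determined by its values at z = 1, q^-1, ..., q^-(a+1).

    At z = q^-h the factor of x_j is
    (q x_j)_(a_j) / prod_(1 <= s <= h) (1 - q^-s / x_j), expanded at infinity.
    By partial fractions, extracting a coefficient from it is a weighted sum of
    evaluations at the poles x_j = q^-s, a_j < s <= h, plus extraction from the
    expansion at 0, which only sees exponents at most -h (ct_coef_node,
    ct_coef_edge). Choose one of the two in every variable; let T be the set of
    variables expanded at 0, and S the rest, evaluated at x_j = q^-(s_j). The
    product D_S vanishes there unless the s_j are far apart, which forces
    h >= 1 + sum_(j in S) a_j, with equality for a single tight configuration
    (spaced_bound). On the other hand the lowest degree in the variables of T is
    too high unless h <= 1 + sum_(j in S) a_j, and in the case of equality T must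
    consist of variables in the denominator x_(i_1) ... x_(i_m)
    (capped_defect). So each T gives one term, at a single node, and this term is
    the constant term of D_T times explicit factors (node_value).

    Without the monomial factor the degree is at most a, and the polynomial
    vanishes at q^-1, ..., q^-a. Its value at 1 is the constant term of the
    Dyson product in x_1, ..., x_n, so the q-Dyson theorem follows by induction;
    the value at q^-(a+1) then evaluates the tight configuration without any
    computation (dyson_poly, q_dyson). With the monomial factor the value at 1
    is 0, and Lagrange interpolation gives a sum over the subsets T of
    I_0 minus {0} (marked_value). An elementary identity splits the term of T
    into the terms of T and of T with 0 added, which is the formula
    (marked_coeff). *)

Set Implicit Arguments.
Unset Strict Implicit.
Unset Printing Implicit Defensive.

Import Order.TTheory GRing.Theory Num.Theory.
Local Open Scope ring_scope.

(** * Coordinatewise functionals on polynomials *)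
Section Tensor.
Variables (K : fieldType) (N : nat).
Implicit Types (p A B : {mpoly K[N]}) (phi psi : 'I_N -> nat -> K).

(** The linear functional that acts on monomials one variable at a time. Taking
    a coefficient, evaluating, or mixing the two from variable to variable are
    all of this kind, so that one can pass from one to the other in each
    variable separately. *)
Definition tens phi p : K := \sum_(m <- msupp p) p@_m * \prod_i phi i (m i).

Lemma tensE phi p k : (msize p <= k)%N ->
  tens phi p = \sum_(m : 'X_{1..N < k}) p@_m * \prod_i phi i (m i).
Proof.
move=> le_pk; rewrite /tens (big_mksub ('X_{1..N < k} : subFinType _)) ?msupp_uniq //=.
- by rewrite big_rmcond //= => m /memN_msupp_eq0 ->; rewrite mul0r.
- by move=> m /msize_mdeg_lt /leq_trans; apply.
Qed.

Lemma tens_is_linear phi : linear_for *%R (tens phi).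
Proof.
move=> c p1 p2; set k := maxn (msize (c *: p1 + p2)) (maxn (msize p1) (msize p2)).
rewrite !(@tensE _ _ k) ?leq_max ?leqnn ?orbT // mulr_sumr -big_split /=.
by apply: eq_bigr => m _; rewrite mcoeffD mcoeffZ mulrDl mulrA.
Qed.

HB.instance Definition _ phi :=
  GRing.isLinear.Build K {mpoly K[N]} K *%R (tens phi) (tens_is_linear phi).

Lemma tensX phi (m : 'X_{1..N}) : tens phi 'X_[m] = \prod_i phi i (m i).
Proof. by rewrite /tens msuppX big_seq1 mcoeffX eqxx mul1r. Qed.

Lemma tens_mpolyE phi p (F : {mpoly K[N]} -> {mpoly K[N]}) :
  linear F ->
  tens phi (F p) = \sum_(m <- msupp p) p@_m * tens phi (F 'X_[m]).
Proof.
move=> linF.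
have F0 : F 0 = 0 by have := linF (-1) 0 0; rewrite !scaleN1r oppr0 addr0 addNr.
rewrite [in LHS](mpolyE p).
elim/big_rec2: _ => [|m y z _ <-]; first by rewrite F0 linear0.
by rewrite linF linearP.
Qed.

Lemma eq_tens phi psi p : (forall i e, phi i e = psi i e) -> tens phi p = tens psi p.
Proof.
by move=> eq_pp; apply: eq_bigr => m _; congr (_ * _); apply: eq_bigr => i _.
Qed.

(** Multilinearity: a decomposition of the functional in each variable becomes
    a sum over all ways to choose one piece per variable. *)
Lemma tens_expand (J : finType) (g : 'I_N -> J -> nat -> K) phi p :
    (forall i e, phi i e = \sum_o g i o e) ->
  tens phi p = \sum_(f : {ffun 'I_N -> J}) tens (fun i => g i (f i)) p.
Proof.
move=> phiE; rewrite exchange_big; apply: eq_bigr => m _ /=.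
rewrite -mulr_sumr -(bigA_distr_bigA (fun i o => g i o (m i))).
by congr (_ * _); apply: eq_bigr => i _.
Qed.

Definition peval (T : {set 'I_N}) (c : 'I_N -> K) (p : {mpoly K[N]}) : {mpoly K[N]} :=
  p \mPo [tuple (if i \in T then 'X_i else (c i)%:MP) | i < N].

Lemma peval_is_linear T c : linear (peval T c).
Proof. by move=> b p1 p2; rewrite /peval linearP. Qed.

Lemma pevalM T c p1 p2 : peval T c (p1 * p2) = peval T c p1 * peval T c p2.
Proof. by rewrite /peval rmorphM. Qed.

Lemma peval_mpolyX T c (m : 'X_{1..N}) :
  peval T c 'X_[m] = (\prod_(i | i \notin T) c i ^+ m i) *:
   'X_[[multinom if i \in T then m i else 0%N | i < N]].
Proof.
rewrite /peval comp_mpolyX (bigID (mem T)) /= mulrC -mul_mpolyC rmorph_prod.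
congr (_ * _).
  apply: eq_bigr => i /negbTE iT; rewrite tnth_mktuple iT.
  by rewrite rmorphXn.
rewrite mpolyXE_id [RHS](bigID (mem T)) /= [X in _ = _ * X]big1 ?mulr1.
  by apply: eq_bigr => i iT; rewrite tnth_mktuple mnmE iT.
by move=> i /negbTE iT; rewrite mnmE iT expr0.
Qed.

(** Variables outside T on which the functional is a multiple of an evaluation
    can be substituted. Afterwards only the exponent 0 occurs in them, so any
    functional with value 1 at 0 would do there; the one supported at 0 makes
    degree bounds in the variables of T automatic. *)
Lemma tens_peval (T : {set 'I_N}) (c d : 'I_N -> K) phi p :
    (forall i e, i \notin T -> phi i e = d i * c i ^+ e) ->
  tens phi p = (\prod_(i | i \notin T) d i) *
   tens (fun i e => if i \in T then phi i e else (e == 0%N)%:R) (peval T c p).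
Proof.
move=> phiE; rewrite (tens_mpolyE _ _ (peval_is_linear T c)) mulr_sumr.
apply: eq_bigr => m _; rewrite mulrCA; congr (_ * _).
rewrite peval_mpolyX linearZ /= tensX mulrA -big_split /= (bigID (mem T)) /= mulrC.
congr (_ * _); first by apply: eq_bigr => i iT; rewrite phiE.
rewrite [RHS](bigID (mem T)) /= [X in _ = _ * X]big1 ?mulr1.
  by apply: eq_bigr => i iT; rewrite mnmE iT.
by move=> i /negbTE iT; rewrite mnmE iT.
Qed.

Lemma tensM phi A B : tens phi (A * B) =
  \sum_(m <- msupp A) \sum_(k <- msupp B)
     A@_m * B@_k * \prod_i phi i (m i + k i)%N.
Proof.
have linA : linear (fun A => A * B).
  by move=> c a1 a2; rewrite mulrDl scalerAl.
rewrite (tens_mpolyE _ _ linA); apply: eq_bigr => m _.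
have linB : linear (fun B => 'X_[m] * B : {mpoly K[N]}).
  by move=> c a1 a2; rewrite mulrDr scalerAr.
rewrite (tens_mpolyE _ _ linB) mulr_sumr; apply: eq_bigr => k _.
rewrite mulrA -mpolyXD tensX; congr (_ * _).
by apply: eq_bigr => i _; rewrite mnmDE.
Qed.

Definition homogeneous d (p : {mpoly K[N]}) := forall m, m \in msupp p -> mdeg m = d.

(** The degree argument: a functional that only sees exponents up to v - h
    cannot see a multiple of a homogeneous polynomial of too large degree. The
    bound is written additively because v - h may be negative. *)
Lemma tens_capped_eq0 phi A B d (h v : 'I_N -> nat) :
    homogeneous d A -> (forall i e, phi i e != 0 -> (e + h i <= v i)%N) ->
    (\sum_i v i < d + \sum_i h i)%N -> tens phi (A * B) = 0.
Proof.
move=> homA cap lt_v; rewrite tensM big_seq big1 // => m mA; rewrite big1 // => k _.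
have [-> | /prodf_neq0 nz] := eqVneq (\prod_i phi i (m i + k i)%N) 0.
  by rewrite mulr0.
have : (d + \sum_i h i <= \sum_i v i)%N.
  rewrite -(homA m mA) mdegE -big_split /=.
  apply: leq_sum => i _; apply: leq_trans (cap i (m i + k i)%N (nz i isT)).
  by rewrite leq_add2r leq_addr.
by rewrite leqNgt lt_v.
Qed.

(** The borderline of the degree argument: only one monomial of A survives,
    together with the constant term of the cofactor B. *)
Lemma tens_capped_eq phi A B d (h : 'I_N -> nat) (w : 'X_{1..N}) :
    homogeneous d A -> (forall i e, phi i e != 0 -> (e + h i <= w i + h i)%N) ->
    mdeg w = d -> tens phi (A * B) = A@_w * B@_0%MM * \prod_i phi i (w i).
Proof.
move=> homA cap dw; rewrite tensM.
have tE m k : m \in msupp A -> (m, k) != (w, 0%MM) ->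
    A@_m * B@_k * \prod_i phi i (m i + k i)%N = 0.
  move=> mA; apply: contraNeq; rewrite mulf_eq0 => /norP[_ /prodf_neq0 nz].
  have le_mw i : (m i + k i <= w i)%N by rewrite -(leq_add2r (h i)) cap ?nz.
  have k0 : k = 0%MM.
    apply/eqP; rewrite -mdeg_eq0 -leqn0 -(leq_add2l d) addn0.
    rewrite -{1}(homA m mA) -dw !mdegE -big_split /=; exact: leq_sum.
  rewrite k0 xpair_eqE eqxx andbT; apply/eqP/mnmP => i.
  apply/eqP; rewrite eqn_leq; apply/andP; split.
    exact: leq_trans (leq_addr _ _) (le_mw i).
  have := homA m mA; rewrite -dw !mdegE (bigD1 i) //= [in RHS](bigD1 i) //= => eq_mw.
  rewrite -(leq_add2r (\sum_(j | j != i) w j)) -eq_mw leq_add2l.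
  by apply: leq_sum => j _; exact: leq_trans (leq_addr _ _) (le_mw j).
have [wA | wA] := boolP (w \in msupp A); last first.
  rewrite (memN_msupp_eq0 wA) !mul0r big_seq big1 // => m mA; rewrite big1 // => k _.
  by apply: tE; rewrite // xpair_eqE; apply: contraNN wA => /andP[/eqP<-].
rewrite (bigD1_seq w) ?msupp_uniq //= [X in _ + X]big1_seq ?addr0; last first.
  move=> m /andP[mw mA]; rewrite big1 // => k _.
  by apply: tE; rewrite // xpair_eqE negb_and mw.
have [B0 | B0] := boolP (0%MM \in msupp B); last first.
  rewrite (memN_msupp_eq0 B0) mulr0 mul0r big_seq big1 // => k kB.
  by apply: tE; rewrite // xpair_eqE eqxx /=; apply: contraNN B0 => /eqP<-.
rewrite (bigD1_seq 0%MM) ?msupp_uniq //= [X in _ + X]big1_seq ?addr0.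
  by congr (_ * _); apply: eq_bigr => i _; rewrite mnm0E addn0.
by move=> k /andP[k0 _]; apply: tE; rewrite // xpair_eqE eqxx.
Qed.

Lemma homogeneousM d e A B : homogeneous d A -> homogeneous e B -> homogeneous (d + e) (A * B).
Proof.
move=> hA hB m /msuppM_le/allpairsP[[m1 m2] /= [m1A m2B ->]].
by rewrite mdegD (hA _ m1A) (hB _ m2B).
Qed.

Lemma homogeneous_prod (I : Type) (r : seq I) (P : pred I) (d : I -> nat)
    (F : I -> {mpoly K[N]}) :
  (forall i, P i -> homogeneous (d i) (F i)) ->
  homogeneous (\sum_(i <- r | P i) d i)%N (\prod_(i <- r | P i) F i).
Proof.
move=> hF; elim/big_rec2: _ => [m | i e p Pi hp]; last exact: homogeneousM (hF i Pi) hp.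
by rewrite msupp1 inE => /eqP->; rewrite mdeg0.
Qed.

(** A polynomial factor in x_j and the pivot x_o is absorbed into the functional
    at j; the pivot is set to 1, so its exponents do not matter. *)
Lemma tens_absorb phi p (o j : 'I_N) (n : nat) (g : nat -> K) (k l : nat -> nat) :
    o != j -> (forall e, phi o e = 1) ->
  tens phi (p * \sum_(s < n) g s *: ('X_j ^+ k s * 'X_o ^+ l s)) =
  tens (fun i e => if i == j then \sum_(s < n) g s * phi j (e + k s)%N else phi i e) p.
Proof.
move=> neq_oj phi_o.
have lin : linear (fun p => p * \sum_(s < n) g s *: ('X_j ^+ k s * 'X_o ^+ l s)
    : {mpoly K[N]}).
  by move=> c a1 a2; rewrite mulrDl scalerAl.
rewrite (tens_mpolyE _ _ lin); apply: eq_bigr => m _; congr (_ * _).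
rewrite mulr_sumr linear_sum /= (bigD1 j) //= eqxx mulr_suml; apply: eq_bigr => s _.
rewrite -scalerAr linearZ /= !mpolyXn -!mpolyXD tensX -mulrA; congr (_ * _).
rewrite (bigD1 j) //=; congr (_ * _).
  congr (phi j _); rewrite !mnmDE !mulmnE !mnm1E eqxx (negbTE neq_oj); lia.
apply: eq_bigr => i ij; rewrite (negbTE ij) !mnmDE !mulmnE !mnm1E.
have [<- | _] := eqVneq o i; first by rewrite !phi_o.
by rewrite [j == i]eq_sym (negbTE ij) !mul0n !addn0.
Qed.

(** In a homogeneous polynomial the exponent of x_o is determined by the others,
    so x_o may be set to 1 before the coefficient is extracted. *)
Lemma mcoeff_tens d p (o : 'I_N) (u : 'X_{1..N}) : homogeneous d p -> mdeg u = d ->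
  p@_u = tens (fun i e => if i == o then 1 else (e == u i)%:R) p.
Proof.
move=> hp du; rewrite /tens.
have tE m : m \in msupp p -> m != u ->
    p@_m * \prod_i (if i == o then 1 else (m i == u i)%:R) = 0.
  move=> mp; apply: contraNeq; rewrite mulf_eq0 => /norP[_ /prodf_neq0 nz].
  have eqmu i : i != o -> m i = u i.
    move=> io; move: (nz i isT); rewrite (negbTE io).
    by case: (m i =P u i) => //= _; rewrite eqxx.
  apply/eqP/mnmP => i; have [-> | /eqmu //] := eqVneq i o.
  have := hp m mp; rewrite -du !mdegE (bigD1 o) //= [in RHS](bigD1 o) //=.
  by rewrite (eq_bigr u) => [/addIn|i' /eqmu].
have [up | up] := boolP (u \in msupp p).
  rewrite (bigD1_seq u) ?msupp_uniq //= [X in _ + X]big1_seq ?addr0.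
    by rewrite big1 ?mulr1 // => i _; rewrite eqxx if_same.
  by move=> m /andP[mu mp]; apply: tE.
rewrite (memN_msupp_eq0 up) big_seq big1 // => m mp; apply: tE => //.
by apply: contraNneq up => <-.
Qed.

End Tensor.

(** * The q-binomial theorem and partial fractions in one variable *)
Lemma tri2 k : ('C(k.+1, 2) * 2 = k * k.+1)%N.
Proof. by elim: k => // k IHk; rewrite binS bin1 mulnDl IHk; lia. Qed.

Section QSeries.
Variables (K : fieldType) (q : K).

Lemma qfactE k : qfact q k = \prod_(r < k) (1 - q ^+ r.+1).
Proof. by apply: eq_bigr => r _; rewrite exprS. Qed.

Lemma qfactS k : qfact q k.+1 = qfact q k * (1 - q ^+ k.+1).
Proof. by rewrite !qfactE big_ord_recr. Qed.

Lemma qfactD k l : qfact q (k + l) = qfact q k * \prod_(r < l) (1 - q ^+ (k + r).+1).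
Proof.
elim: l => [|l IHl]; first by rewrite addn0 big_ord0 mulr1.
by rewrite addnS qfactS IHl big_ord_recr mulrA.
Qed.

Definition csign b : K := (-1) ^+ b * q ^+ 'C(b.+1, 2).

(** The coefficient in pochhammer_expand, with z in place of q^a; it makes sense
    for every z and is a polynomial of degree e in z. *)
Definition poch_coef b z e : K :=
  csign b * \prod_(r < e) ((z - q ^+ r / q ^+ b) / (1 - q ^+ r.+1)).

(** The value on x^e of the functional that multiplies by the Laurent polynomial
    (1/x)_a (q x)_b, with z = q^a, and then takes the coefficient of x^v. *)
Definition ct_coef b v z e : K := if (v <= e + b)%N then poch_coef b z (e + b - v) else 0.

(** At z = q^-h the factor (1/x)_a (q x)_b becomes
    (q x)_b / prod_(1 <= s <= h) (1 - q^-s / x), whose poles are the q^-s with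
    b < s <= h. In the variable t = q^(b + e - v) the values of ct_coef with
    e - v > -h are those of pole_poly divided by t^h, and its coefficients are, up to powers
    of q, the weights of the evaluations at the poles. *)
Definition pole_poly b h : {poly K} :=
  (csign b / qfact q (h - b.+1)) *: \prod_(i < h - b.+1) (1 - q ^+ i.+1 *: 'X).

Definition pole_weight b h s : K :=
  if (b < s)%N then (pole_poly b h)`_(h - s) / q ^+ (s * b) else 0.

Definition pole_sum b h v e : K :=
  \sum_(s < h.+1) pole_weight b h s * (q ^- s) ^+ e * q ^+ (s * v).

Lemma size_pole_poly b h : (size (pole_poly b h) <= (h - b.+1).+1)%N.
Proof.
rewrite (leq_trans (size_scale_leq _ _)) //.
elim: (h - b.+1)%N => [|d IHd]; first by rewrite big_ord0 size_poly1.
rewrite big_ord_recr /= (leq_trans (size_polyMleq _ _)) //.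
have : (size (1 - q ^+ d.+1 *: 'X)%R <= 2)%N.
  rewrite (leq_trans (size_polyD _ _)) // geq_max size_poly1 size_polyN.
  by rewrite (leq_trans (size_scale_leq _ _)) // size_polyX.
by move=> sB; have := leq_add IHd sB; rewrite addn2; case: (_ + _)%N.
Qed.

Lemma horner_pole_poly b h t : (pole_poly b h).[t] =
  csign b / qfact q (h - b.+1) * \prod_(i < h - b.+1) (1 - q ^+ i.+1 * t).
Proof.
rewrite hornerZ horner_prod; congr (_ * _); apply: eq_bigr => i _.
by rewrite hornerD hornerN hornerZ hornerX hornerC.
Qed.

Lemma pole_sum_small b h v e : (h <= b)%N -> pole_sum b h v e = 0.
Proof.
move=> le_hb; rewrite /pole_sum big1 // => s _; rewrite /pole_weight ltnNge.
by rewrite (leq_trans _ le_hb) ?mul0r // -ltnS.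
Qed.

Hypothesis q0 : q != 0.

Lemma qpow_neq0 k : q ^+ k != 0. Proof. exact: expf_neq0. Qed.

Lemma qfactV k :
  \prod_(r < k) (1 - (q ^+ r.+1)^-1) = (-1) ^+ k * qfact q k / q ^+ 'C(k.+1, 2).
Proof.
elim: k => [|k IHk]; first by rewrite /qfact /qpoch !big_ord0 mulr1 divr1.
rewrite big_ord_recr /= IHk qfactS (binS k.+1 1) bin1 exprD !exprS.
by field; rewrite q0 !qpow_neq0.
Qed.

Lemma pole_sumE b h v e (t := q ^+ b * q ^+ e / q ^+ v) : (b < h)%N ->
  pole_sum b h v e = (pole_poly b h).[t] / t ^+ h.
Proof.
move=> lt_bh; have t0 : t != 0 by rewrite !mulf_neq0 ?invr_eq0 ?qpow_neq0.
rewrite (@horner_coef_wide _ h.+1); last first.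
  by apply: leq_trans (size_pole_poly _ _) _; lia.
rewrite /pole_sum mulr_suml (reindex_inj rev_ord_inj); apply: eq_bigr => i _.
rewrite /= subSS /pole_weight; have le_ih : (i <= h)%N by rewrite -ltnS.
case: ltnP => [_ | le_hib]; last first.
  rewrite nth_default ?mul0r //; apply: leq_trans (size_pole_poly _ _) _; lia.
rewrite subKn // -[in t ^+ h](subnK le_ih) exprD.
have -> : t ^+ (h - i) = q ^+ ((h - i) * b) * q ^+ ((h - i) * e) / q ^+ ((h - i) * v).
  by rewrite exprMn exprVn exprMn -!exprM ![((h - i) * _)%N]mulnC.
rewrite exprVn -exprM; field.
by rewrite !qpow_neq0 expf_neq0.
Qed.

Hypothesis q1 : forall k, (0 < k)%N -> q ^+ k != 1.

Lemma subqX_neq0 k : 1 - q ^+ k.+1 != 0.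
Proof. by rewrite subr_eq0 eq_sym q1. Qed.

Lemma qfact_neq0 k : qfact q k != 0.
Proof. by rewrite qfactE; apply/prodf_neq0 => r _; exact: subqX_neq0. Qed.

Definition gcoef (y : K) M s : K :=
  \prod_(r < s) (y * (q ^+ M - q ^+ r) / (1 - q ^+ r.+1)).

Lemma gcoefE y M s :
  gcoef y M s = y ^+ s * \prod_(r < s) (q ^+ M - q ^+ r) / qfact q s.
Proof.
rewrite qfactE -prodfV -[X in y ^+ X]card_ord -prodr_const -!big_split /=.
by apply: eq_bigr.
Qed.

Lemma gcoefS y M s : gcoef y M.+1 s.+1 = gcoef y M s.+1 - y * q ^+ M * gcoef y M s.
Proof.
have PS : \prod_(r < s.+1) (q ^+ M.+1 - q ^+ r) =
    (q ^+ M.+1 - 1) * q ^+ s * \prod_(r < s) (q ^+ M - q ^+ r).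
  rewrite big_ord_recl expr0 -mulrA; congr (_ * _).
  have -> : q ^+ s = \prod_(r < s) q by rewrite prodr_const card_ord.
  rewrite -big_split /=.
  by apply: eq_bigr => r _; rewrite /= !exprS mulrBr.
rewrite !gcoefE PS big_ord_recr /= qfactS.
have nz := subqX_neq0 s; have nz' := qfact_neq0 s.
move: nz; rewrite !exprS => nz.
by field; rewrite nz' nz.
Qed.

Lemma gauss_binomial (R : comAlgType K) (x w : R) (y : K) M :
  \prod_(r < M) (x - (y * q ^+ r) *: w) =
  \sum_(s < M.+1) gcoef y M s *: (x ^+ (M - s) * w ^+ s).
Proof.
elim: M => [|M IHM].
  by rewrite big_ord0 big_ord1 /gcoef big_ord0 scale1r subnn !expr0 mulr1.
have gM : gcoef y M M.+1 = 0.
  by rewrite gcoefE big_ord_recr /= subrr !(mulr0, mul0r).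
have xS : x * \prod_(r < M) (x - (y * q ^+ r) *: w) =
   \sum_(s < M.+2) gcoef y M s *: (x ^+ (M.+1 - s) * w ^+ s).
  rewrite big_ord_recr /= gM scale0r addr0 IHM mulr_sumr; apply: eq_bigr => s _.
  by rewrite -scalerAr mulrA -exprS subSn // -ltnS.
rewrite big_ord_recr /= mulrC mulrBl xS -scalerAl IHM.
rewrite big_ord_recl [in RHS]big_ord_recl -addrA; congr (_ + _).
  by rewrite /gcoef !big_ord0.
rewrite mulr_sumr scaler_sumr -sumrB; apply: eq_bigr => s _.
rewrite lift0 gcoefS subSS scalerBl; congr (_ - _).
by rewrite -scalerAr scalerA exprS mulrCA.
Qed.

(** After extracting signs and powers of q, the two products on the left are
    consecutive parts of one product to which gauss_binomial applies. *)
Lemma pochhammer_expand (R : comAlgType K) (x w : R) a b :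
  \prod_(r < a) (x - q ^+ r *: w) * \prod_(r < b) (w - q ^+ r.+1 *: x) =
  \sum_(s < (a + b).+1) poch_coef b (q ^+ a) s *: (x ^+ (a + b - s) * w ^+ s).
Proof.
have -> : \prod_(r < b) (w - q ^+ r.+1 *: x) =
    csign b *: \prod_(r < b) (x - ((q ^+ b)^-1 * q ^+ r) *: w).
  elim: b => [|b IHb]; first by rewrite !big_ord0 /csign expr0 mul1r scale1r.
  rewrite big_ord_recr /= IHb [in RHS]big_ord_recl /=.
  have -> : \prod_(r < b) (x - ((q ^+ b.+1)^-1 * q ^+ bump 0 r) *: w) =
      \prod_(r < b) (x - ((q ^+ b)^-1 * q ^+ r) *: w).
    apply: eq_bigr => r _; rewrite /bump add1n !exprS; congr (_ - _ *: _).
    by field; rewrite q0 qpow_neq0.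
  have -> : w - q ^+ b.+1 *: x =
      - q ^+ b.+1 *: (x - ((q ^+ b.+1)^-1 * q ^+ 0) *: w).
    rewrite scalerBr scalerA expr0 mulr1 mulNr mulfV ?qpow_neq0 //.
    by rewrite !scaleNr scale1r opprK addrC.
  rewrite -scalerAr -scalerAl scalerA [X in _ *: X = _]mulrC; congr (_ *: _).
  by rewrite /csign (binS b.+1 1) bin1 exprD !exprS; ring.
rewrite -scalerAr [X in csign b *: X]mulrC.
have -> : \prod_(r < a) (x - q ^+ r *: w) =
   \prod_(r < a) (x - ((q ^+ b)^-1 * q ^+ (b + r)) *: w).
  by apply: eq_bigr => r _; rewrite exprD mulKf ?qpow_neq0.
pose F r := x - ((q ^+ b)^-1 * q ^+ r) *: w.
have -> : \prod_(r < b) F r * \prod_(r < a) F (b + r)%N = \prod_(r < b + a) F r.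
  by rewrite big_split_ord.
rewrite gauss_binomial scaler_sumr addnC; apply: eq_bigr => s _.
rewrite scalerA; congr (_ *: _); rewrite /poch_coef /gcoef; congr (_ * _).
apply: eq_bigr => r _; congr (_ / _).
by rewrite exprD; field; exact: qpow_neq0.
Qed.

(** Partial fractions: for exponents e - v > -h, taking the coefficient in the
    expansion at infinity amounts to a weighted sum of evaluations at the poles.
    For e + b < v both sides vanish, the right-hand one because pole_poly has
    the roots q^-1, ..., q^-(h - b - 1). *)
Lemma ct_coef_node b h v e : (v < e + h)%N -> ct_coef b v (q ^- h) e = pole_sum b h v e.
Proof.
move=> lt_v; case: (leqP h b) => [le_hb | lt_bh].
  rewrite pole_sum_small // /ct_coef; case: leqP => // le_v; rewrite /poch_coef.
  have lt_r : (b - h < e + b - v)%N by lia.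
  rewrite (bigD1 (Ordinal lt_r)) //= -[in q ^+ b](subnK le_hb) exprD.
  by rewrite invfM mulVKf ?qpow_neq0 // subrr !(mul0r, mulr0).
rewrite pole_sumE // horner_pole_poly /ct_coef; case: leqP => [le_v | lt_ev].
  have -> : q ^+ b * q ^+ e / q ^+ v = q ^+ (e + b - v).
    by rewrite -exprD addnC -[in LHS](subnK le_v) exprD mulfK ?qpow_neq0.
  set ep := (e + b - v)%N; set d := (h - b.+1)%N.
  rewrite /poch_coef -[in RHS]mulrA -[in RHS]mulrA; congr (csign b * _).
  have -> : \prod_(r < ep) ((q ^- h - q ^+ r / q ^+ b) / (1 - q ^+ r.+1)) =
     (q ^- h) ^+ ep * \prod_(r < ep) (1 - q ^+ (d + r).+1) / qfact q ep.
    have -> : (q ^- h) ^+ ep = \prod_(r < ep) q ^- h by rewrite prodr_const card_ord.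
    rewrite qfactE -prodfV -!big_split /=.
    apply: eq_bigr => r _; congr (_ / _); rewrite mulrBr mulr1; congr (_ - _).
    have -> : (d + r).+1 = (r + (h - b))%N by rewrite /d; lia.
    rewrite -[in q ^- h](subnK (ltnW lt_bh)) !exprD; field.
    by rewrite !qpow_neq0.
  have -> : \prod_(i < d) (1 - q ^+ i.+1 * q ^+ ep) = \prod_(i < d) (1 - q ^+ (ep + i).+1).
    by apply: eq_bigr => i _; rewrite -exprD addSn addnC.
  have := qfactD ep d; rewrite addnC qfactD => eq_d.
  rewrite exprVn -!exprM mulnC.
  apply: (mulfI (qfact_neq0 ep)); apply: (mulfI (qfact_neq0 d)).
  transitivity (q ^- (ep * h) * (qfact q d * \prod_(r < ep) (1 - q ^+ (d + r).+1))).
    by field; rewrite qfact_neq0 qpow_neq0.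
  by rewrite eq_d; field; rewrite qfact_neq0 qpow_neq0.
have lt_r : ((v - e - b).-1 < h - b.+1)%N by lia.
have root : 1 - q ^+ (v - e - b) * (q ^+ b * q ^+ e / q ^+ v) = 0.
  rewrite -!exprD mulrA -exprD (_ : (v - e - b + (b + e) = v)%N); last by lia.
  by rewrite mulfV ?qpow_neq0 ?subrr.
rewrite (bigD1 (Ordinal lt_r)) //= prednK; last by lia.
by rewrite root !(mul0r, mulr0).
Qed.

(** Outside the range of ct_coef_node the two functionals differ by the
    coefficient in the expansion at 0, which starts at exponent h. Only its
    leading coefficient is needed. *)
Lemma ct_coef_edge b h v e : (e + h = v)%N ->
  ct_coef b v (q ^- h) e - pole_sum b h v e = csign h.
Proof.
move=> eq_v; case: (leqP h b) => [le_hb | lt_bh].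
  rewrite pole_sum_small // subr0 /ct_coef -eq_v leq_add2l le_hb subnDl.
  rewrite /poch_coef; set m := (b - h)%N.
  have -> : b = (h + m)%N by rewrite subnKC.
  have -> : \prod_(r < m) ((q ^- h - q ^+ r / q ^+ (h + m)) / (1 - q ^+ r.+1)) =
     (q ^- h) ^+ m * \prod_(r < m) (1 - (q ^+ r.+1)^-1) / qfact q m.
    rewrite [in RHS](reindex_inj rev_ord_inj) /=.
    have -> : (q ^- h) ^+ m = \prod_(r < m) q ^- h by rewrite prodr_const card_ord.
    rewrite qfactE -prodfV -!big_split /=.
    apply: eq_bigr => r _; congr (_ / _); rewrite mulrBr mulr1; congr (_ - _).
    rewrite -subSn // subSS exprD.
    have -> : q ^+ m = q ^+ (m - r) * q ^+ r by rewrite -exprD subnK // ltnW.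
    by field; rewrite !qpow_neq0.
  rewrite qfactV exprVn -exprM /csign.
  have -> : 'C((h + m).+1, 2) = ('C(h.+1, 2) + h * m + 'C(m.+1, 2))%N.
    have := tri2 (h + m); have := tri2 h; have := tri2 m; nia.
  rewrite (exprD (-1)) (exprD q (_ + _)) (exprD q 'C(_, _)).
  have : ((-1) ^+ m : K) * (-1) ^+ m = 1.
    by rewrite -expr2 sqrr_sign.
  move: ((-1) ^+ m) => sg sg2.
  transitivity ((-1) ^+ h * q ^+ 'C(h.+1, 2) * (sg * sg)).
    by field; rewrite !qpow_neq0 qfact_neq0.
  by rewrite sg2 mulr1.
rewrite /ct_coef -eq_v leqNgt ltn_add2l lt_bh /= sub0r pole_sumE // horner_pole_poly.
set d := (h - b.+1)%N; have hE : h = (d + b.+1)%N by rewrite subnK.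
have -> : q ^+ b * q ^+ e / q ^+ (e + h) = (q ^+ d.+1)^-1.
  rewrite hE !exprD !exprS; field; rewrite !qpow_neq0 q0 //.
have -> : \prod_(i < d) (1 - q ^+ i.+1 * (q ^+ d.+1)^-1) =
    \prod_(r < d) (1 - (q ^+ r.+1)^-1).
  rewrite [in RHS](reindex_inj rev_ord_inj) /=; apply: eq_bigr => i _.
  rewrite -subSn // subSS.
  have -> : q ^+ d.+1 = q ^+ (d - i) * q ^+ i.+1.
    by rewrite -exprD addnS subnK // ltnW.
  by congr (_ - _); field; rewrite !qpow_neq0.
rewrite qfactV exprVn -exprM invrK.
have sg2 : ((-1) ^+ b : K) * (-1) ^+ d = - (-1) ^+ h.
  by rewrite -exprD hE addnS exprS mulN1r opprK addnC.
have -> : - (csign b / qfact q d * ((-1) ^+ d * qfact q d / q ^+ 'C(d.+1, 2)) *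
      q ^+ (d.+1 * h)) =
    - ((-1) ^+ b * (-1) ^+ d) * (q ^+ 'C(b.+1, 2) * q ^+ (d.+1 * h) / q ^+ 'C(d.+1, 2)).
  by rewrite /csign; field; rewrite qpow_neq0 qfact_neq0.
rewrite sg2 opprK -exprD; congr (_ * _).
have -> : ('C(b.+1, 2) + d.+1 * h)%N = ('C(h.+1, 2) + 'C(d.+1, 2))%N.
  have := tri2 b; have := tri2 h; have := tri2 d; rewrite hE; nia.
by rewrite exprD mulfK ?qpow_neq0.
Qed.

End QSeries.

(** * Spacing of the poles *)
Section Spacing.
Variables (n : nat) (a : 'I_n.+1 -> nat).
Implicit Types (S A T : {set 'I_n.+1}).

Definition tight S (i : 'I_n.+1) : nat := (\sum_(r in S | (i <= r)%N) a r).+1.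

Lemma sigmaD1 S u : u \in S -> sigma a S = (a u + sigma a (S :\ u))%N.
Proof. by move=> uS; rewrite /sigma (big_setD1 u). Qed.

(** The condition on s under which the Dyson polynomial does not vanish at the
    point (q^-s_i), see dysonp_eval_spaced. *)
Definition spaced S (s : 'I_n.+1 -> nat) := forall i j, i \in S -> j \in S -> i != j ->
  ((s i < s j + (j < i)) || (s j + a i + (j < i) <= s i))%N.

(** Listing S by increasing s, with the larger index first in case of a tie,
    each step to an index i increases s by at least a_i, and by one more when
    the index goes up. Hence the largest value exceeds the sum of the a_i, and
    the extremal configuration is unique: the indices decrease and every step
    is as small as possible. *)
Lemma spaced_bound S s h : (0 < h)%N ->
    (forall i, i \in S -> (a i < s i <= h)%N) -> spaced S s ->
  (sigma a S < h)%N /\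
  (h = (sigma a S).+1 -> forall i, i \in S -> s i = tight S i).
Proof.
have [k] := ubnP #|S|; elim: k => // k IHk in S h * => leSk h_gt0 bd sp.
have [-> | [u0 u0S]] := set_0Vmem S.
  by split=> [|_ i]; rewrite ?inE // /sigma big_set0.
(* the weight selects the smallest index among those with maximal s *)
have [u uS umax] := @arg_maxnP _ u0 (mem S) (fun i => s i * n.+1 + (n - i))%N u0S.
have {}uS : u \in S := uS.
have gap r : r \in S -> r != u -> (s r + a u + (r < u) <= s u)%N.
  move=> rS ru; have := sp u r uS rS; rewrite eq_sym ru => /(_ isT) /orP[|//].
  have := umax r rS; have := ltn_ord r; have := ltn_ord u; move: ru.
  rewrite -val_eqE /=; case: (ltngtP r u) => //= lt_ru _ lun lrn le_ru lt_su; nia.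
have le_uh : (s u <= h)%N by case/andP: (bd u uS).
have gt_u : (a u < s u)%N by case/andP: (bd u uS).
have h'_gt0 : (0 < h - a u)%N by lia.
have S'S i : i \in S :\ u -> i \in S by rewrite inE => /andP[].
have cS' : (#|S :\ u| < k)%N by move: leSk; rewrite (cardsD1 u) uS.
have bd' i : i \in S :\ u -> (a i < s i <= h - a u)%N.
  rewrite !inE => /andP[iu iS]; have := gap i iS iu; have := bd i iS; lia.
have sp' : spaced (S :\ u) s by move=> i j /S'S iS /S'S jS; apply: sp.
have [lt_h eq_h] := IHk (S :\ u) _ cS' h'_gt0 bd' sp'.
rewrite (sigmaD1 uS); split=> [|hE]; first lia.
have hE' : (h - a u)%N = (sigma a (S :\ u)).+1 by lia.
have {}eq_h := eq_h hE'.
have [S'0 | [r1 r1S']] := set_0Vmem (S :\ u).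
  move=> i iS; have -> : i = u.
    by apply/eqP/negPn/negP => iu; have := in_set0 i; rewrite -S'0 !inE iu iS.
  rewrite /tight (bigD1 u) ?uS ?leqnn //= big1 => [|r /andP[/andP[rS _] ru]].
    by move: hE; rewrite S'0 /sigma big_set0; lia.
  by have := in_set0 r; rewrite -S'0 !inE ru rS.
have [r0 r0S' r0min] := @arg_minnP _ r1 (mem (S :\ u)) (fun i => i : nat) r1S'.
have {}r0S' : r0 \in S :\ u := r0S'.
have r0E : s r0 = (h - a u)%N.
  rewrite eq_h // hE -addnS addKn /tight /sigma; congr _.+1.
  apply: eq_bigl => r; case: (boolP (r \in _)) => //= rS'; exact: r0min.
have [r0u r0S] : r0 != u /\ r0 \in S by move: r0S'; rewrite !inE => /andP[].
have := gap r0 r0S r0u; rewrite r0E => le_su.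
have u_r0 : (u < r0)%N.
  move: le_su r0u; rewrite -val_eqE /=; case: (ltngtP r0 u) => //=; lia.
have u_lt r : r \in S -> r != u -> (u < r)%N.
  by move=> rS ru; apply: leq_trans u_r0 _; apply: r0min; rewrite !inE ru.
move=> i iS; have [-> | iu] := eqVneq i u.
  transitivity h; first lia.
  rewrite hE -sigmaD1 // /sigma /tight; congr _.+1; apply: eq_bigl => r.
  case: (boolP (r \in S)) => //= rS; have [-> | ru] := eqVneq r u; first by rewrite leqnn.
  by rewrite ltnW ?u_lt.
rewrite eq_h ?inE ?iu //= /tight; congr _.+1; apply: eq_bigl => r; rewrite !inE.
have [-> | ru //] := eqVneq r u.
by rewrite /= uS /= leqNgt u_lt.
Qed.

End Spacing.

(** * The Dyson polynomial *)
Section PairProducts.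
Variables (R : comNzRingType) (J : finType) (f : J -> J -> R).
Implicit Types A S T : {set J}.

Definition pairprod A := \prod_(i in A) \prod_(j in A | j != i) f i j.

Lemma pairprod_split A T : T \subset A ->
  pairprod A = pairprod (A :\: T) * pairprod T *
     \prod_(s in A :\: T) \prod_(t in T) (f s t * f t s).
Proof.
move=> sTA; set S := A :\: T.
have inner i : i \in A -> \prod_(j in A | j != i) f i j =
    \prod_(j in T | j != i) f i j * \prod_(j in S | j != i) f i j.
  move=> iA; rewrite (bigID (mem T)) /=; congr (_ * _); apply: eq_bigl => j.
    by case: (boolP (j \in T)) => jT; rewrite ?andbF ?andbT // (subsetP sTA).
  by rewrite inE; case: (j \in T); rewrite ?andbF ?andbT.
have disj i j : i \in T -> j \in S -> j != i.
  by move=> iT; rewrite inE => /andP[jT _]; apply: contraNneq jT => ->.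
rewrite /pairprod (bigID (mem T)) /=.
have -> : \prod_(i in A | i \in T) \prod_(j in A | j != i) f i j =
    pairprod T * \prod_(s in S) \prod_(t in T) f t s.
  rewrite exchange_big -big_split /=; apply: eq_big => i.
    by case: (boolP (i \in T)) => iT; rewrite ?andbF ?andbT // (subsetP sTA).
  move=> /andP[iA iT]; rewrite inner //; congr (_ * _); apply: eq_bigl => j.
  by case: (boolP (j \in S)) => //= jS; rewrite (disj i).
have -> : \prod_(i in A | i \notin T) \prod_(j in A | j != i) f i j =
    pairprod S * \prod_(s in S) \prod_(t in T) f s t.
  rewrite -big_split /=; apply: eq_big => i; first by rewrite inE andbC.
  move=> /andP[iA iT]; rewrite inner // mulrC; congr (_ * _); apply: eq_bigl => j.
  case: (boolP (j \in T)) => //= jT; rewrite eq_sym (disj j) //.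
  by rewrite inE iT.
rewrite mulrACA [pairprod T * _]mulrC -!mulrA; congr (_ * (_ * _)).
rewrite mulrC -big_split; apply: eq_bigr => s _ /=.
by rewrite -big_split.
Qed.

End PairProducts.

Section Dyson.
Variables (K : fieldType) (q : K).
Variables (n : nat) (a : 'I_n.+1 -> nat).
Implicit Types (S A T : {set 'I_n.+1}).
Local Notation N := n.+1.
Local Notation mp := {mpoly K[N]}.

(** The numerator of (x_i / x_j)_(a_i) when i < j, and of (q x_i / x_j)_(a_i)
    when j < i. *)
Definition pfac (i j : 'I_N) : mp :=
  \prod_(r < a i) ('X_j - q ^+ (r + (j < i)) *: 'X_i).

(** The Dyson product in the variables of A, multiplied by the monomial with
    exponents dexp A that clears its denominators. *)
Definition dysonp A : mp := pairprod pfac A.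

Definition dexp A (j : 'I_N) : nat := if j \in A then (sigma a A - a j)%N else 0%N.

Definition dyson_ct A : K := (dysonp A)@_[multinom dexp A j | j < N].

Lemma homogeneous_pfac i j : homogeneous (a i) (pfac i j).
Proof.
rewrite -[a i]muln1 -{1}[a i]card_ord -sum_nat_const.
apply: homogeneous_prod => r _ m /msuppB_le; rewrite mem_cat => /orP[].
  by rewrite msuppX inE => /eqP->; rewrite mdeg1.
by move=> /msuppZ_le; rewrite msuppX inE => /eqP->; rewrite mdeg1.
Qed.

Lemma homogeneous_dysonp A : homogeneous (\sum_j dexp A j)%N (dysonp A).
Proof.
have -> : (\sum_j dexp A j = \sum_(i in A) \sum_(j in A | j != i) a i)%N.
  rewrite (exchange_big_dep (mem A)) => [|i j _ /andP[]//] /=.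
  rewrite [RHS]big_mkcond; apply: eq_bigr => j _; rewrite /dexp; case: ifP => // jA.
  rewrite /sigma (bigD1 j) //= addKn; apply: eq_bigl => i.
  by rewrite ?jA eq_sym.
apply: homogeneous_prod => i _; apply: homogeneous_prod => j _.
exact: homogeneous_pfac.
Qed.

Lemma sum_dexp A : (\sum_j dexp A j = \sum_(j in A) (sigma a A - a j))%N.
Proof. by rewrite [RHS]big_mkcond. Qed.

Lemma pfac_eval (c : 'I_N -> K) i j :
  (pfac i j).@[c] = \prod_(r < a i) (c j - q ^+ (r + (j < i)) * c i).
Proof.
rewrite /pfac rmorph_prod; apply: eq_bigr => r _.
by rewrite /= mevalB mevalZ !mevalXU.
Qed.

Lemma eq_dysonp_eval S (c d : 'I_N -> K) : {in S, c =1 d} ->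
  (dysonp S).@[c] = (dysonp S).@[d].
Proof.
move=> eq_cd; rewrite /dysonp /pairprod !rmorph_prod; apply: eq_bigr => i iS.
rewrite !rmorph_prod; apply: eq_bigr => j /andP[jS _].
by rewrite /= !pfac_eval; apply: eq_bigr => r _; rewrite !eq_cd.
Qed.

Lemma peval_pfac T (c : 'I_N -> K) i j (x := fun i => if i \in T then 'X_i else (c i)%:MP) :
  peval T c (pfac i j) = \prod_(r < a i) (x j - q ^+ (r + (j < i)) *: x i) :> mp.
Proof.
rewrite /peval /pfac rmorph_prod; apply: eq_bigr => r _.
by rewrite /= comp_mpolyB comp_mpolyZ !comp_mpolyXU -!tnth_nth !tnth_mktuple.
Qed.

(** The factors that couple S and T once the variables outside T have been
    evaluated: polynomials in the variables of T. *)
Definition cross S T (c : 'I_N -> K) : mp :=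
  \prod_(s in S) \prod_(t in T) (peval T c (pfac s t) * peval T c (pfac t s)).

Lemma peval_dysonp A T (c : 'I_N -> K) : T \subset A ->
  peval T c (dysonp A) =
    (dysonp (A :\: T)).@[c] *: (dysonp T * cross (A :\: T) T c).
Proof.
move=> sTA; rewrite {1}/dysonp (pairprod_split _ sTA) /peval !rmorphM /= -mul_mpolyC mulrA.
congr (_ * _ * _).
- rewrite /dysonp /pairprod !rmorph_prod; apply: eq_bigr => i; rewrite inE => /andP[iT _].
  rewrite !rmorph_prod; apply: eq_bigr => j; rewrite inE => /andP[/andP[jT _] _].
  rewrite /= pfac_eval -[LHS]/(peval T c (pfac i j)) peval_pfac rmorph_prod.
  apply: eq_bigr => r _; rewrite (negbTE iT) (negbTE jT).
  by rewrite rmorphB rmorphM /= mul_mpolyC.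
- rewrite /dysonp /pairprod rmorph_prod; apply: eq_bigr => i iT.
  rewrite rmorph_prod; apply: eq_bigr => j /andP[jT _].
  by rewrite -[LHS]/(peval T c (pfac i j)) peval_pfac iT jT.
- rewrite rmorph_prod; apply: eq_bigr => s _; rewrite rmorph_prod.
  by apply: eq_bigr => t _; rewrite rmorphM.
Qed.

Lemma cross0 S T (c : 'I_N -> K) : [disjoint S & T] ->
  (cross S T c)@_0%MM = \prod_(s in S) \prod_(t in T)
     ((\prod_(r < a s) (- (q ^+ (r + (t < s)) * c s))) * c s ^+ a t).
Proof.
move=> dST; rewrite rmorph_prod; apply: eq_bigr => s sS.
rewrite rmorph_prod; apply: eq_bigr => t tT.
have sT : s \notin T by rewrite (disjointFr dST).
rewrite rmorphM !peval_pfac !rmorph_prod (negbTE sT) tT /=.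
have mX (i : 'I_N) : ('X_i : mp)@_0%MM = 0.
  by rewrite mcoeffX mnm1_eq0.
congr (_ * _).
  by apply: eq_bigr => r _; rewrite mcoeffB mcoeffZ mX mcoeffC eqxx mulr1 sub0r.
rewrite -[X in _ ^+ X]card_ord -prodr_const; apply: eq_bigr => r _.
by rewrite mcoeffB mcoeffZ mX mcoeffC eqxx mulr1 mulr0 subr0.
Qed.

Hypothesis q0 : q != 0.

Lemma dysonp_eval_spaced S (s : 'I_N -> nat) (c : 'I_N -> K) :
    (forall i, i \in S -> c i = q ^- s i) -> (dysonp S).@[c] != 0 -> spaced a S s.
Proof.
move=> cE; rewrite /dysonp /pairprod rmorph_prod => /prodf_neq0 nz i j iS jS ij.
have := nz i iS; rewrite rmorph_prod => /prodf_neq0 /(_ j).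
rewrite jS eq_sym ij => /(_ isT); rewrite /= pfac_eval => /prodf_neq0 nzr.
case: ltnP => //= le_ji; rewrite leqNgt; apply/negP => lt_ij.
have lt_r : (s i - s j - (j < i) < a i)%N by lia.
have /negP[] := nzr (Ordinal lt_r) isT; rewrite /= !cE //.
rewrite subnK; last lia.
rewrite subr_eq0 -{2}[s i](subnK (leq_trans (leq_addr _ _) le_ji)) exprD.
by rewrite invfM mulVKf ?expf_neq0.
Qed.

End Dyson.

(** * The constant term at z = q^-h *)
Section Nodes.
Variables (K : fieldType) (q : K).
Variables (n : nat) (a : 'I_n.+1 -> nat).
Local Notation N := n.+1.
Local Notation mp := {mpoly K[N]}.
Variables (A I : {set 'I_N}) (p : 'X_{1..N}) (c0 : 'I_N -> K).
Implicit Types (S T : {set 'I_N}).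

(** The exponent of x_j in the monomial whose coefficient in
    dysonp A * x^p is the constant term of x^p D_A / prod_(i in I) x_i. *)
Definition shift (j : 'I_N) : nat := (sigma a A - a j + (j \in I))%N.

(** What remains of the extraction of a constant term once a further variable
    x_o, with exponent a_o and z = q^(a_o), has been eliminated. The variables
    outside A are evaluated at c0. *)
Definition elimfun z (i : 'I_N) e : K :=
  if i \in A then ct_coef q (a i) (shift i) z e else c0 i ^+ e.

(** The pieces of elimfun at z = q^-h in one variable: index 0 is the expansion
    at 0, index s.+1 is the evaluation at the pole q^-s. Outside A only s = 0
    is used, to carry the evaluation at c0. *)
Definition node_factor h (i : 'I_N) (o : nat) e : K :=
  if o is s.+1 then
    if i \in A then pole_weight q (a i) h s * q ^+ (s * shift i) * (q ^- s) ^+ e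
    else (s == 0%N)%:R * c0 i ^+ e
  else
    if i \in A then ct_coef q (a i) (shift i) (q ^- h) e - pole_sum q (a i) h (shift i) e
    else 0.

Lemma elimfun_node_factor h i e :
  elimfun (q ^- h) i e = \sum_(o < h.+2) node_factor h i o e.
Proof.
rewrite /elimfun big_ord_recl /=; case: ifP => iA.
  rewrite -[LHS](subrK (pole_sum q (a i) h (shift i) e)); congr (_ + _).
  by apply: eq_bigr => s _; rewrite mulrAC.
rewrite big_ord_recl /= mul1r big1 ?addr0 ?add0r // => s _.
by rewrite mul0r.
Qed.

Lemma sigmaU T : T \subset A -> sigma a A = (sigma a T + sigma a (A :\: T))%N.
Proof.
by move=> sTA; rewrite /sigma (big_setID T) /= (setIidPr sTA).
Qed.

Lemma leq_sigma T i : i \in T -> (a i <= sigma a T)%N.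
Proof. by move=> iT; rewrite /sigma (bigD1 i) //= leq_addr. Qed.

Definition node_point (s : 'I_N -> nat) (i : 'I_N) : K := if i \in A then q ^- s i else c0 i.

Definition node_weight h (s : 'I_N -> nat) (i : 'I_N) : K :=
  if i \in A then pole_weight q (a i) h (s i) * q ^+ (s i * shift i) else (s i == 0%N)%:R.

Definition capped h T (i : 'I_N) e : K :=
  if i \in T then node_factor h i 0 e else (e == 0%N)%:R.

(** With the expansion at 0 chosen exactly in T, the other variables are
    evaluated and the Dyson polynomial factors accordingly. *)
Lemma tens_node_factor h T (s : 'I_N -> nat) : T \subset A ->
  tens (fun i => node_factor h i (if i \in T then 0%N else (s i).+1)) (dysonp q a A * 'X_[p]) =
  (\prod_(i | i \notin T) node_weight h s i) * (dysonp q a (A :\: T)).@[node_point s] *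
  (\prod_(i | i \notin T) node_point s i ^+ p i) *
  tens (capped h T)
   (dysonp q a T * 'X_[[multinom if i \in T then p i else 0%N | i < N]] *
      cross q a (A :\: T) T (node_point s)).
Proof.
move=> sTA; rewrite (@tens_peval _ _ T (node_point s) (node_weight h s)) => [|i e iT]; last first.
  by rewrite (negbTE iT) /= /node_weight /node_point; case: ifP.
rewrite -[RHS]mulrA -[RHS]mulrA; congr (_ * _).
have -> : peval T (node_point s) (dysonp q a A * 'X_[p]) =
   ((dysonp q a (A :\: T)).@[node_point s] * \prod_(i | i \notin T) node_point s i ^+ p i) *:
    (dysonp q a T * 'X_[[multinom if i \in T then p i else 0%N | i < N]] *
      cross q a (A :\: T) T (node_point s)).
  rewrite pevalM peval_dysonp // peval_mpolyX -scalerAl -scalerAr scalerA; congr (_ *: _).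
  by rewrite mulrAC.
rewrite linearZ /= -[LHS]mulrA; congr (_ * (_ * _)).
by apply: eq_tens => i e; rewrite /capped; case: ifP => iT; rewrite ?iT.
Qed.

Lemma homogeneousX (m : 'X_{1..N}) : homogeneous (mdeg m) ('X_[m] : mp).
Proof. by move=> m'; rewrite msuppX inE => /eqP->. Qed.

Lemma prod_background T (F : 'I_N -> K) : T \subset A ->
    (forall i, i \notin A -> F i = 1) ->
  \prod_(i | i \notin T) F i = \prod_(i in A :\: T) F i.
Proof.
move=> sTA F1; rewrite (bigID (mem A)) /= [X in _ * X]big1 ?mulr1.
  by apply: eq_bigl => i; rewrite inE.
by move=> i /andP[_ /F1].
Qed.

(** The contribution of T: the variables of A :\: T sit at the tight point, and
    the variables of T contribute the lowest terms of the remaining polynomial. *)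
Definition nodeterm T : K :=
  let S := A :\: T in let s := tight a S in let h := (sigma a S).+1 in
  (\prod_(i in S) node_weight h s i) * (dysonp q a S).@[node_point s] *
  (\prod_(i in S) node_point s i ^+ p i) *
  (dyson_ct q a T * (cross q a S T (node_point s))@_0%MM * csign q h ^+ #|T|).

Definition admissible h T := [&& T \subset A, T \subset I, [forall t in T, p t == 0%N] &
   (sigma a (A :\: T)).+1 == h].

(** Compares the degree of the polynomial in the variables of T with the largest
    degree visible in the expansions at 0. Each t in T costs at least
    h - sigma a (A :\: T) >= 1 and gains at most 1, when t is in I. *)
Lemma capped_defect h T t : (sigma a (A :\: T) < h)%N -> T \subset A -> t \in T ->
   ((t \notin I) || (p t != 0%N) || ((sigma a (A :\: T)).+1 != h)) ->
  (\sum_i (if i \in T then shift i else 0) <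
   mdeg [multinom dexp a T j | j < N] +
   mdeg [multinom if i \in T then p i else 0%N | i < N]
    + \sum_i (if i \in T then h else 0))%N.
Proof.
move=> lt_h sTA tT bad; rewrite !mdegE -!big_split /= (bigD1 t) //= [ltnRHS](bigD1 t) //=.
rewrite -addSn; apply: leq_add; last first.
  apply: leq_sum => i _; rewrite !mnmE /dexp /shift; case: ifP => // iT.
  by rewrite (sigmaU sTA); have := leq_sigma iT; case: (i \in I); lia.
rewrite !mnmE /dexp /shift tT (sigmaU sTA); have := leq_sigma tT.
by move: bad; case: (t \in I); case: eqP => //= ?; try lia; case: eqP => //= ?; lia.
Qed.

Hypothesis q0 : q != 0.

Hypothesis q1 : forall k, (0 < k)%N -> q ^+ k != 1.

Hypothesis p_supp : forall i, i \notin A -> p i = 0%N.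

Lemma node_cap h i e : node_factor h i 0 e != 0 -> (e + h <= shift i)%N.
Proof.
rewrite /=; case: ifP => [_|_]; last by rewrite eqxx.
by case: leqP => // lt_v; rewrite ct_coef_node // subrr eqxx.
Qed.

Lemma capped_cap h T i e : capped h T i e != 0 ->
  (e + (if i \in T then h else 0) <= if i \in T then shift i else 0)%N.
Proof.
rewrite /capped; case: ifP => _; first exact: node_cap.
by case: e => [|e] /=; rewrite ?eqxx.
Qed.

(** The two constraints meet: nonvanishing of the evaluated Dyson polynomial
    bounds sigma a (A :\: T) from above by h - 1, the degrees in the variables
    of T bound it from below. *)
Lemma tens_node_factor_neq0 h T (s : 'I_N -> nat) : (0 < h <= (sigma a A).+1)%N ->
    T \subset A ->
    tens (fun i => node_factor h i (if i \in T then 0%N else (s i).+1))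
      (dysonp q a A * 'X_[p]) != 0 -> (forall i, i \in A -> s i <= h)%N ->
  admissible h T /\ forall i, i \notin T -> s i = if i \in A then tight a (A :\: T) i else 0%N.
Proof.
move=> /andP[h_gt0 le_h] sTA; rewrite tens_node_factor // => nz le_sh.
move: nz; rewrite !mulf_eq0 !negb_or => /andP[/andP[/andP[/prodf_neq0 wnz Dnz] _] tnz].
have bd i : i \in A :\: T -> (a i < s i <= h)%N.
  rewrite inE => /andP[iT iA]; rewrite le_sh // andbT.
  have := wnz i iT; rewrite /node_weight iA mulf_eq0 negb_or => /andP[+ _].
  by rewrite /pole_weight; case: ifP => //; rewrite eqxx.
have sp : spaced a (A :\: T) s.
  apply: (dysonp_eval_spaced q0 _ Dnz) => i.
  by rewrite inE => /andP[_ iA]; rewrite /node_point iA.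
have [lt_h tightE] := spaced_bound h_gt0 bd sp.
have ok t : t \in T -> ~~ ((t \notin I) || (p t != 0%N) || ((sigma a (A :\: T)).+1 != h)).
  move=> tT; apply: contra tnz => bad; apply/eqP.
  apply: tens_capped_eq0 (capped_cap (h := h) (T := T)) (capped_defect lt_h sTA tT bad).
  apply: homogeneousM; last exact: homogeneousX.
  by rewrite mdegE; under eq_bigr do rewrite mnmE; apply: homogeneous_dysonp.
have hE : (sigma a (A :\: T)).+1 = h.
  have [T0 | [t tT]] := set_0Vmem T.
    by move: lt_h; rewrite T0 setD0 => lt_h; apply/eqP; rewrite eqn_leq lt_h.
  by have := ok t tT; rewrite !negb_or negbK => /andP[_ /negPn/eqP].
split.
  apply/and4P; split; rewrite ?hE //.
    by apply/subsetP => t /ok; rewrite !negb_or negbK => /andP[/andP[]].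
  by apply/forall_inP => t /ok; rewrite !negb_or => /andP[/andP[_ /negPn]].
move=> i iT; case: ifPn => iA; first by apply: tightE; rewrite // inE iT.
apply/eqP; have := wnz i iT; rewrite /node_weight (negbTE iA).
by case: (s i =P 0%N) => //= _; rewrite eqxx.
Qed.

Lemma tens_node_factor_tight h T (s : 'I_N -> nat) : admissible h T ->
    (forall i, i \notin T -> s i = if i \in A then tight a (A :\: T) i else 0%N) ->
  tens (fun i => node_factor h i (if i \in T then 0%N else (s i).+1)) (dysonp q a A * 'X_[p])
   = nodeterm T.
Proof.
case/and4P=> sTA sTI /forall_inP p0 /eqP hE sE; rewrite tens_node_factor // /nodeterm hE.
set S := A :\: T.
have ptE i : i \in S -> node_point s i = node_point (tight a S) i.
  by rewrite inE => /andP[iT iA]; rewrite /node_point iA sE // iA.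
rewrite !prod_background //; last 2 first.
- by move=> i iA; rewrite p_supp.
- move=> i iA; rewrite /node_weight (negbTE iA) sE ?(negbTE iA) ?eqxx //.
  by apply: contra iA => /(subsetP sTA).
congr (_ * _ * _ * _).
- by apply: eq_bigr => i; rewrite inE => /andP[iT iA]; rewrite /node_weight iA sE // iA.
- by apply: eq_dysonp_eval => i; exact: ptE.
- by apply: eq_bigr => i iS; rewrite ptE.
have p0E : [multinom if i \in T then p i else 0%N | i < N] = 0%MM.
  by apply/mnmP => i; rewrite mnmE mnm0E; case: ifP => // /p0/eqP.
have shiftE i : i \in T -> (dexp a T i + h = shift i)%N.
  move=> iT; rewrite /dexp /shift iT (subsetP sTI) // (sigmaU sTA) -hE.
  by have := leq_sigma iT; lia.
rewrite p0E mpolyX0 mulr1.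
rewrite (@tens_capped_eq _ _ _ _ _ (mdeg [multinom dexp a T j | j < N])
  (fun i => if i \in T then h else 0%N) [multinom dexp a T j | j < N]) //; first last.
- move=> i e /capped_cap; rewrite mnmE; case: ifP => iT; first by rewrite shiftE.
  by move=> le_e; apply: leq_trans le_e _.
- by rewrite mdegE; under eq_bigr do rewrite mnmE; apply: homogeneous_dysonp.
have dST : [disjoint S & T].
  by rewrite disjoints_subset; apply/subsetP => i; rewrite !inE => /andP[].
have -> : (cross q a S T (node_point s))@_0%MM = (cross q a S T (node_point (tight a S)))@_0%MM.
  by rewrite !cross0 //; apply: eq_bigr => i iS; apply: eq_bigr => t _; rewrite ptE.
have -> : \prod_i capped h T i ([multinom dexp a T j | j < N] i) = csign q h ^+ #|T|.
  rewrite (bigID (mem T)) /= [X in _ * X]big1 ?mulr1.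
    rewrite -prodr_const; apply: eq_bigr => i iT.
    by rewrite /capped mnmE iT /= (subsetP sTA) // ct_coef_edge // shiftE.
  by move=> i /negbTE iT; rewrite /capped mnmE /dexp iT.
by [].
Qed.

(** One term for each T that can be expanded at 0; the poles of the other
    variables are then forced. *)
Lemma node_value h : (0 < h <= (sigma a A).+1)%N ->
  tens (elimfun (q ^- h)) (dysonp q a A * 'X_[p]) =
  \sum_(T : {set 'I_N} | admissible h T) nodeterm T.
Proof.
move=> bh; rewrite (@tens_expand _ _ 'I_h.+2 (fun i o => node_factor h i (val o))); last first.
  exact: elimfun_node_factor.
(* a choice of pieces is encoded by f; Tof f is where the expansion at 0 is chosen *)
pose Tof (f : {ffun 'I_N -> 'I_h.+2}) := [set i | f i == ord0].
pose ftight (T : {set 'I_N}) : {ffun 'I_N -> 'I_h.+2} :=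
  [ffun i => inord (if i \in T then 0 else
             (if i \in A then tight a (A :\: T) i else 0).+1)%N].
have fE (f : {ffun 'I_N -> 'I_h.+2}) i :
    val (f i) = if i \in Tof f then 0%N else (val (f i)).-1.+1.
  by rewrite inE -val_eqE /=; case: (val (f i)).
have WE (f : {ffun 'I_N -> 'I_h.+2}) :
  tens (fun i => node_factor h i (val (f i))) (dysonp q a A * 'X_[p]) =
    tens (fun i => node_factor h i (if i \in Tof f then 0%N else (val (f i)).-1.+1))
      (dysonp q a A * 'X_[p]).
  by apply: eq_tens => i e; rewrite -fE.
have W0 (f : {ffun 'I_N -> 'I_h.+2}) :
  tens (fun i => node_factor h i (val (f i))) (dysonp q a A * 'X_[p]) != 0 ->
    admissible h (Tof f) /\ f = ftight (Tof f).
  move=> nz; have sTA : Tof f \subset A.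
    apply/subsetP => i; rewrite inE => /eqP fi; apply: contraNT nz => iA.
    rewrite /tens big1 // => m _; rewrite (bigD1 i) //= fi /= (negbTE iA).
    by rewrite mul0r mulr0.
  have le_f i : i \in A -> ((val (f i)).-1 <= h)%N.
    by move=> _; have := ltn_ord (f i); rewrite /=; lia.
  move: nz; rewrite WE => /(tens_node_factor_neq0 bh sTA)/(_ le_f)[gT sE]; split=> //.
  apply/ffunP => i; rewrite ffunE; apply: val_inj; rewrite fE.
  have [iT | iT] := boolP (i \in Tof f); first by rewrite /= inordK.
  by rewrite -sE // /= inordK //; have := ltn_ord (f i); rewrite /=; lia.
rewrite (partition_big Tof xpredT) //= [RHS]big_mkcond; apply: eq_bigr => T _.
case: ifPn => gT; last first.
  rewrite big1 // => f /eqP fT; apply: contraNeq gT => /W0[].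
  by rewrite fT.
have /and4P[sTA _ _ /eqP hE] := gT.
have ltI i : i \notin T -> i \in A -> (tight a (A :\: T) i <= h)%N.
  move=> iT iA; rewrite -hE /tight ltnS /sigma big_mkcondr.
  by apply: leq_sum => j _; case: ifP.
have fvE i : val (ftight T i) = if i \in T then 0%N else
   (if i \in A then tight a (A :\: T) i else 0).+1%N.
  rewrite ffunE /= inordK //; case: ifPn => // iT; case: ifPn => // iA.
  by rewrite ltnS ltnS ltI.
have Tft : Tof (ftight T) = T.
  by apply/setP => i; rewrite inE -val_eqE fvE; case: ifP.
rewrite (bigD1 (ftight T)) ?Tft ?eqxx //= big1 ?addr0 => [|f /andP[/eqP fT]].
  rewrite -(@tens_node_factor_tight h T
      (fun i => if i \in A then tight a (A :\: T) i else 0%N) gT) //.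
  by apply: eq_tens => i e; rewrite fvE.
by apply: contraNeq => /W0[_ ->]; rewrite fT.
Qed.

(** At z = 1 there are no poles and only nonpositive exponents are seen, so the
    total degree leaves at most one monomial. *)
Lemma unit_value (v : 'X_{1..N}) : (forall i, v i = if i \in A then shift i else 0%N) ->
  (mdeg v <= mdeg [multinom dexp a A j | j < N] + mdeg p)%N ->
  tens (elimfun 1) (dysonp q a A * 'X_[p]) =
    if (mdeg v == mdeg [multinom dexp a A j | j < N] + mdeg p)%N
    then (dysonp q a A * 'X_[p])@_v else 0.
Proof.
move=> vE le_v.
have homG : homogeneous (mdeg [multinom dexp a A j | j < N] + mdeg p)%N
    (dysonp q a A * 'X_[p]).
  apply: homogeneousM; last exact: homogeneousX.
  by rewrite mdegE; under eq_bigr do rewrite mnmE; apply: homogeneous_dysonp.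
have p_out : [multinom if i \in A then p i else 0%N | i < N] = p.
  by apply/mnmP => i; rewrite mnmE; case: ifPn => // /p_supp.
rewrite (@tens_peval _ _ A c0 (fun=> 1)) => [|i e iA]; last first.
  by rewrite /elimfun (negbTE iA) mul1r.
rewrite big1 ?mul1r //; rewrite pevalM peval_dysonp // peval_mpolyX p_out.
rewrite big1 ?scale1r => [|i iA]; last by rewrite p_supp.
rewrite /cross setDv big_set0 mulr1 -scalerAl linearZ /=.
rewrite /dysonp {1}/pairprod big_set0 meval1 mul1r -/(dysonp q a A).
set phi := (fun i e => _); rewrite -[dysonp q a A * _]mulr1.
have cap i e : phi i e != 0 -> (e + 0 <= v i)%N.
  rewrite /phi vE /elimfun; case: ifP => iA; last by case: e => // e; rewrite eqxx.
  rewrite addn0; case: leqP => // lt_v; rewrite -[1]invr1 -(expr0 q).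
  have {}lt_v : (shift i < e + 0)%N by rewrite addn0.
  by rewrite iA ct_coef_node // pole_sum_small // eqxx.
case: eqP => dv; last first.
  apply: (@tens_capped_eq0 _ _ _ _ _ _ (fun=> 0%N) v homG) => //.
  rewrite sum_nat_const muln0 addn0 -mdegE.
  by move: le_v dv; rewrite leq_eqVlt => /orP[/eqP|].
rewrite (@tens_capped_eq _ _ _ _ _ _ (fun=> 0%N) v homG) //; last first.
  by move=> i e /cap; rewrite !addn0.
rewrite mulr1 mcoeff1 eqxx mulr1 big1 ?mulr1 // => i _.
rewrite /phi vE /elimfun; case: ifP => iA; rewrite iA //.
rewrite -[X in ct_coef _ _ _ X]invr1 -[X in X^-1](expr0 q).
have := @ct_coef_edge _ _ q0 q1 (a i) 0 (shift i) (shift i).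
by rewrite pole_sum_small // subr0 addn0 => ->; rewrite // /csign expr0 mul1r.
Qed.

End Nodes.

(** * Eliminating a variable, and the q-Dyson theorem *)
Section Elim.
Variables (K : fieldType) (q : K).
Variables (n : nat) (a : 'I_n.+1 -> nat).
Local Notation N := n.+1.
Local Notation mp := {mpoly K[N]}.
Implicit Types (A B I S T : {set 'I_N}).

Lemma tens_absorb_seq (phi : 'I_N -> nat -> K) (G : mp) (o : 'I_N) (r : seq 'I_N)
    (m : 'I_N -> nat) (g : 'I_N -> nat -> K) (k l : 'I_N -> nat -> nat) :
    uniq r -> o \notin r -> (forall e, phi o e = 1) ->
  tens phi (G * \prod_(j <- r) \sum_(s < m j) g j s *: ('X_j ^+ k j s * 'X_o ^+ l j s)) =
  tens (fun i e => if i \in r then \sum_(s < m i) g i s * phi i (e + k i s)%N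
                   else phi i e) G.
Proof.
move=> + + phi_o; elim: r G => [|j r IHr] G /=; first by rewrite big_nil mulr1.
rewrite inE negb_or => /andP[jr ur] /andP[oj our].
rewrite big_cons mulrA IHr // tens_absorb //; last by move=> e; rewrite (negbTE our).
apply: eq_tens => i e; rewrite inE; have [-> | _] //= := eqVneq i j.
by apply: eq_bigr => s _; rewrite (negbTE jr).
Qed.

Lemma dysonpU1 A o : o \notin A ->
  dysonp q a (o |: A) = dysonp q a A * \prod_(j in A) (pfac q a o j * pfac q a j o).
Proof.
move=> oA; rewrite /dysonp (pairprod_split _ (subsetUr [set o] A)) setDUl setDv setU0.
have -> : [set o] :\: A = [set o] by apply/setDidPl; rewrite disjoints1.
rewrite big_set1 {1}/pairprod big_set1 big1 ?mul1r // => j.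
by rewrite inE => /andP[-> ].
Qed.

(** Since poch_coef b z e has degree e in z, so that x^e in ct_coef contributes
    degree e + b - v, the degree in z is governed by the total degree of G. *)
Lemma elim_poly A I c0 (G : mp) d D : homogeneous d G ->
    (d + sigma a A <= D + \sum_(i in A) shift a A I i)%N ->
  exists2 L : {poly K}, (size L <= D.+1)%N &
    forall z, L.[z] = tens (elimfun q a A I c0 z) G.
Proof.
move=> homG le_d.
pose betaP b e : {poly K} := csign q b *:
  \prod_(r < e) ((1 - q ^+ r.+1)^-1 *: ('X - (q ^+ r / q ^+ b)%:P)).
have betaPE b e z : (betaP b e).[z] = poch_coef q b z e.
  rewrite hornerZ horner_prod; congr (_ * _); apply: eq_bigr => r _.
  by rewrite hornerZ hornerXsubC mulrC.
have size_betaP b e : (size (betaP b e) <= e.+1)%N.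
  rewrite (leq_trans (size_scale_leq _ _)) //.
  elim: e => [|e IHe]; first by rewrite big_ord0 size_poly1.
  rewrite big_ord_recr /= (leq_trans (size_polyMleq _ _)) //.
  set Y := _ *: _; have sY : (size Y <= 2)%N.
    by rewrite (leq_trans (size_scale_leq _ _)) // size_XsubC.
  by have := leq_add IHe sY; rewrite addn2; case: (_ + _)%N.
pose lamP b v e := if (v <= e + b)%N then betaP b (e + b - v)%N else 0.
pose ellP (m : 'X_{1..N}) (i : 'I_N) : {poly K} :=
  if i \in A then lamP (a i) (shift a A I i) (m i) else (c0 i ^+ m i)%:P.
exists (\sum_(m <- msupp G) G@_m *: \prod_i ellP m i).
  rewrite big_seq; apply: (big_ind (fun L : {poly K} => (size L <= D.+1)%N)).
  - by rewrite size_poly0.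
  - move=> L1 L2 s1 s2; apply: leq_trans (size_polyD _ _) _.
    by rewrite geq_max s1.
  move=> m mG; apply: leq_trans (size_scale_leq _ _) _.
  have [-> | nz] := eqVneq (\prod_i ellP m i) 0; first by rewrite size_poly0.
  have le_v i : i \in A -> (shift a A I i <= m i + a i)%N.
    move=> iA; move: nz => /prodf_neq0/(_ i isT); rewrite /ellP iA /lamP.
    by case: ifP => //; rewrite eqxx.
  have szi i : ((size (ellP m i)).-1 <= if i \in A then m i + a i - shift a A I i else 0)%N.
    rewrite /ellP; case: ifP => iA; last by rewrite size_polyC; case: (_ != 0).
    by rewrite /lamP le_v //; have := size_betaP (a i) (m i + a i - shift a A I i)%N; lia.
  have : ((size (\prod_i ellP m i)%R).-1 <= \sum_i (size (ellP m i)).-1)%N.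
    elim/big_rec2: _ => [|i x y _ le_xy]; first by rewrite size_poly1.
    by have := size_polyMleq (ellP m i) y; lia.
  move=> le_sz; rewrite -[X in (X <= _)%N](prednK _) ?lt0n ?size_poly_eq0 // ltnS.
  apply: leq_trans le_sz _; apply: leq_trans (leq_sum _ (fun i _ => szi i)) _.
  rewrite -big_mkcond /=.
  have -> : (\sum_(i in A) (m i + a i - shift a A I i) =
       \sum_(i in A) m i + sigma a A - \sum_(i in A) shift a A I i)%N.
    by rewrite /sigma -big_split /= sumnB.
  rewrite leq_subLR [leqRHS]addnC; apply: (leq_trans _ le_d); rewrite leq_add2r -(homG m mG) mdegE.
  by rewrite [leqRHS](bigID (mem A)) leq_addr.
move=> z; rewrite horner_sum; apply: eq_bigr => m _; rewrite hornerZ horner_prod.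
congr (_ * _); apply: eq_bigr => i _; rewrite /ellP /elimfun; case: ifP => _.
  by rewrite /lamP /ct_coef; case: ifP; rewrite ?horner0.
by rewrite hornerC.
Qed.

Hypothesis q0 : q != 0.

Lemma poch_coef_gt b c s : (c + b < s)%N -> poch_coef q b (q ^+ c) s = 0.
Proof.
move=> lt_s; rewrite /poch_coef (bigD1 (Ordinal lt_s)) //= exprD mulfK ?expf_neq0 //.
by rewrite subrr !(mul0r, mulr0).
Qed.

Lemma ct_coef_sum b c v e :
  \sum_(s < (c + b).+1) poch_coef q b (q ^+ c) s * ((e + (c + b - s))%N == (v + c)%N)%:R
  = ct_coef q b v (q ^+ c) e.
Proof.
have sE (s : 'I_(c + b).+1) : ((e + (c + b - s) == v + c) = (e + b == v + s))%N.
  by have := ltn_ord s => lt_s; apply/eqP/eqP; lia.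
rewrite /ct_coef; case: leqP => [le_v | lt_v]; last first.
  rewrite big1 // => s _; rewrite sE; case: eqP; rewrite ?mulr0 //; lia.
have [le_s | lt_s] := leqP (e + b - v) (c + b).
  have le_s' : (e + b - v < (c + b).+1)%N by [].
  rewrite (bigD1 (Ordinal le_s')) //= big1 => [|s].
    have -> : (e + (c + b - (e + b - v)) == v + c)%N by apply/eqP; lia.
    by rewrite mulr1 addr0.
  rewrite -val_eqE /= => s_neq; rewrite sE; case: eqP; rewrite ?mulr0 //; lia.
rewrite poch_coef_gt // big1 // => s _; rewrite sE; have := ltn_ord s.
case: eqP; rewrite ?mulr0 //; lia.
Qed.

Hypothesis q1 : forall k, (0 < k)%N -> q ^+ k != 1.

(** The smallest index o plays the role of x_0: put x_o = 1 and expand the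
    factors of D that involve x_o by pochhammer_expand. The result depends on
    a_o only through z = q^(a_o). *)
Lemma elimination A I o (p u : 'X_{1..N}) :
    o \notin A -> (forall j, j \in A -> (o < j)%N) ->
    (forall j, j \in A -> u j = shift a A I j + a o)%N ->
    (forall j, j \notin A -> j != o -> u j = 0%N) ->
    mdeg u = (mdeg [multinom dexp a (o |: A) j | j < N] + mdeg p)%N ->
  (dysonp q a (o |: A) * 'X_[p])@_u =
  tens (elimfun q a A I (fun i => (i == o)%:R) (q ^+ a o)) (dysonp q a A * 'X_[p]).
Proof.
move=> oA lt_o uA u0 du.
have homG : homogeneous (mdeg u) (dysonp q a (o |: A) * 'X_[p]).
  rewrite du; apply: homogeneousM; last exact: homogeneousX.
  by rewrite mdegE; under eq_bigr do rewrite mnmE; apply: homogeneous_dysonp.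
rewrite (mcoeff_tens o homG (erefl _)) dysonpU1 // mulrAC.
have -> : \prod_(j in A) (pfac q a o j * pfac q a j o) =
   \prod_(j <- enum A) \sum_(s < (a o + a j).+1)
     poch_coef q (a j) (q ^+ a o) s *: ('X_j ^+ (a o + a j - s) * 'X_o ^+ s) :> mp.
  rewrite -big_enum /= big_seq [RHS]big_seq; apply: eq_bigr => j.
  rewrite mem_enum => jA; rewrite -pochhammer_expand // /pfac; congr (_ * _).
    by apply: eq_bigr => r _; rewrite ltnNge ltnW ?lt_o ?addn0.
  by apply: eq_bigr => r _; rewrite lt_o ?addn1.
rewrite (tens_absorb_seq (o := o) _ (fun j => (a o + a j).+1)
  (fun j => poch_coef q (a j) (q ^+ a o)) (fun j s => a o + a j - s)%N (fun j s => s));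
  rewrite ?enum_uniq ?mem_enum ?eqxx //.
apply: eq_tens => i e; rewrite mem_enum /elimfun; case: ifPn => iA.
  have io : i != o by apply: contraNneq oA => <-.
  by rewrite -ct_coef_sum (negbTE io) uA.
case: eqVneq => io; first by rewrite expr1n.
by rewrite u0 // expr0n.
Qed.

Lemma expf_inj : injective (fun k : nat => q ^+ k).
Proof.
move=> i j /=; wlog le_ij : i j / (i <= j)%N => [H | eq_q].
  by case/orP: (leq_total i j) => [/H//|le_ji eq_q]; apply/esym/H.
have := q1 (k := j - i); case: (ltnP i j) => [lt_ij | le_ji _].
  rewrite subn_gt0 lt_ij => /(_ isT)/eqP[].
  by apply: (mulfI (expf_neq0 i q0)); rewrite -exprD subnKC // mulr1.
by apply/eqP; rewrite eqn_leq le_ij.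
Qed.

(** The nodes q^0, q^-1, ..., q^-D are distinct because q is not a root of
    unity. *)
Lemma eq_poly_nodes D (L M : {poly K}) : (size L <= D.+1)%N -> (size M <= D.+1)%N ->
  (forall h, (h <= D)%N -> L.[q ^- h] = M.[q ^- h]) -> L = M.
Proof.
move=> sL sM eqLM; apply/eqP; rewrite -subr_eq0; apply/eqP.
apply: (@roots_geq_poly_eq0 _ _ [seq q ^- h | h <- iota 0 D.+1]).
- apply/allP => _ /mapP[h + ->]; rewrite mem_iota add0n ltnS => /andP[_ le_h].
  by rewrite rootE hornerD hornerN eqLM // subrr.
- rewrite map_inj_uniq ?iota_uniq // => i j /invr_inj; exact: expf_inj.
- rewrite size_map size_iota (leq_trans (size_polyD _ _)) // geq_max sL.
  by rewrite size_polyN.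
Qed.

Lemma dyson_ct0 : dyson_ct q a set0 = 1.
Proof.
rewrite /dyson_ct /dysonp /pairprod big_set0 mcoeff1.
by rewrite (_ : _ == _) //; apply/eqP/mnmP => i; rewrite !mnmE /dexp inE.
Qed.

(** The evaluated Dyson polynomial at the tight point with the weights of the
    poles. Its value, found in dyson_poly, comes out of the interpolation and is
    never computed from the product. *)
Definition tight_residue S : K :=
  (\prod_(i in S) (pole_weight q (a i) (sigma a S).+1 (tight a S i) *
      q ^+ (tight a S i * (sigma a S - a i)))) *
  (dysonp q a S).@[fun i => q ^- tight a S i].

Lemma nodeterm0 A c0 : nodeterm q a A set0 0%MM c0 set0 = tight_residue A.
Proof.
rewrite /nodeterm setD0 cards0 expr0 dyson_ct0 cross0 ?mul1r ?mulr1; last first.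
  by rewrite disjoints_subset setC0 subsetT.
rewrite [X in _ * X * _]big1 => [|i _]; last by rewrite mnm0E.
rewrite mulr1 [X in _ * X]big1 ?mulr1 => [|i _]; last by rewrite big_set0.
congr (_ * _); last first.
  by apply: eq_dysonp_eval => i iA; rewrite /node_point iA.
by apply: eq_bigr => i iA; rewrite /node_weight iA /shift inE addn0.
Qed.

(** Without marked variables no T is admissible at q^-1, ..., q^-(sigma a A), so
    these are the roots of a polynomial of degree at most sigma a A, which is
    then fixed by its value at z = 1. Its value at the next node is the tight
    residue. *)
Lemma dyson_poly A c0 (z : K) :
  tens (elimfun q a A set0 c0 z) (dysonp q a A) =
    dyson_ct q a A * \prod_(k < sigma a A) ((1 - z * q ^+ k.+1) / (1 - q ^+ k.+1)) /\
  tight_residue A = dyson_ct q a A * ((-1) ^+ sigma a A / q ^+ 'C((sigma a A).+1, 2)).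
Proof.
have p0 (i : 'I_N) : i \notin A -> (0%MM : 'X_{1..N}) i = 0%N by rewrite mnm0E.
have GE : dysonp q a A * 'X_[0%MM] = dysonp q a A by rewrite mpolyX0 mulr1.
have [|L sL LE] := @elim_poly A set0 c0 _ _ (sigma a A) (@homogeneous_dysonp _ q _ a A).
  rewrite sum_dexp addnC leq_add2l; apply: leq_sum => i _.
  by rewrite /shift inE addn0.
have v0 i : [multinom dexp a A j | j < N] i = if i \in A then shift a A set0 i else 0%N.
  by rewrite mnmE /dexp /shift inE addn0.
have L1 : L.[1] = dyson_ct q a A.
  rewrite LE -GE (unit_value c0 q0 q1 p0 v0) ?mdeg0 ?addn0 ?eqxx // GE //.
have Lh h : (0 < h <= (sigma a A).+1)%N ->
    L.[q ^- h] = if (h == (sigma a A).+1)%N then tight_residue A else 0.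
  move=> bh; rewrite LE -GE (node_value _ c0 q0 q1 p0 bh).
  have good T : admissible a A set0 0%MM h T = (T == set0) && (h == (sigma a A).+1).
    rewrite /admissible subset0; have [-> | //] := eqVneq T set0; last by rewrite andbF.
    rewrite sub0set setD0 eq_sym /=; case: eqP; rewrite ?andbF // andbT => _.
    by apply/forall_inP => t; rewrite inE.
  rewrite (eq_bigl _ _ good); case: eqP => [_|_]; last first.
    by rewrite big_pred0 // => T; rewrite andbF.
  by rewrite (big_pred1 set0) => [|T]; rewrite ?andbT ?nodeterm0.
pose M : {poly K} := dyson_ct q a A *:
   \prod_(k < sigma a A) ((1 - q ^+ k.+1)^-1 *: (1 - q ^+ k.+1 *: 'X)).
have ME z' : M.[z'] =
    dyson_ct q a A * \prod_(k < sigma a A) ((1 - z' * q ^+ k.+1) / (1 - q ^+ k.+1)).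
  rewrite hornerZ horner_prod; congr (_ * _); apply: eq_bigr => k _.
  by rewrite hornerZ hornerD hornerN hornerZ hornerX hornerC mulrC [z' * _]mulrC.
have sM : (size M <= (sigma a A).+1)%N.
  rewrite (leq_trans (size_scale_leq _ _)) //.
  elim: (sigma a A) => [|d IHd]; first by rewrite big_ord0 size_poly1.
  rewrite big_ord_recr /= (leq_trans (size_polyMleq _ _)) //.
  set Y := _ *: _; have sY : (size Y <= 2)%N.
    rewrite (leq_trans (size_scale_leq _ _)) // (leq_trans (size_polyD _ _)) //.
    rewrite geq_max size_poly1 size_polyN.
    by rewrite (leq_trans (size_scale_leq _ _)) // size_polyX.
  by have := leq_add IHd sY; rewrite addn2; case: (_ + _)%N.
have LM : L = M.
  apply: eq_poly_nodes sL sM _ => -[|h] le_h.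
    rewrite expr0 invr1 L1 ME big1 ?mulr1 // => k _.
    by rewrite mul1r divff ?subqX_neq0.
  rewrite Lh; last by rewrite /= ltnS ltnW.
  rewrite eqSS (ltn_eqF le_h).
  by rewrite ME (bigD1 (Ordinal le_h)) //= mulVf ?expf_neq0 // subrr !(mul0r, mulr0).
split; first by rewrite -LE LM ME.
have := Lh (sigma a A).+1; rewrite ltnSn eqxx => <- //; rewrite LM ME; congr (_ * _).
set s := sigma a A.
have -> : \prod_(k < s) ((1 - q ^- s.+1 * q ^+ k.+1) / (1 - q ^+ k.+1)) =
    \prod_(k < s) (1 - (q ^+ k.+1)^-1) / qfact q s.
  rewrite [in RHS](reindex_inj rev_ord_inj) /= qfactE -prodfV -big_split /=.
  apply: eq_bigr => i _; congr (_ / _); rewrite -subSn // subSS.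
  have -> : q ^+ s.+1 = q ^+ (s - i) * q ^+ i.+1.
    by rewrite -exprD addnS subnK // ltnW.
  by congr (_ - _); field; rewrite !expf_neq0.
by rewrite qfactV // mulrAC mulrK ?unitfE ?qfact_neq0.
Qed.

(** The Zeilberger-Bressoud theorem, by induction on A: remove the smallest
    index with elimination and use dyson_poly at z = q^(a_o). *)
Theorem q_dyson A :
  dyson_ct q a A = qfact q (sigma a A) / \prod_(i in A) qfact q (a i).
Proof.
have [k] := ubnP #|A|; elim: k => // k IHk in A *.
have [-> _ | [o1 o1A]] := set_0Vmem A.
  by rewrite dyson_ct0 /sigma !big_set0 /qfact /qpoch big_ord0 divr1.
have [o oA omin] := @arg_minnP _ o1 (mem A) (fun i => i : nat) o1A.
have {}oA : o \in A := oA.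
rewrite (cardsD1 o) oA ltnS => lt_k; have := IHk _ lt_k; clear IHk.
set B := A :\ o => IHB; have AE : A = o |: B by rewrite setD1K.
have oB : o \notin B by rewrite !inE eqxx.
have sAE : sigma a A = (a o + sigma a B)%N by rewrite (sigmaD1 a oA).
pose u := [multinom dexp a A j | j < N].
have uB j : j \in B -> u j = (shift a B set0 j + a o)%N.
  move=> jB; rewrite mnmE /dexp /shift inE addn0 sAE.
  move: (jB); rewrite !inE => /andP[_ ->]; have := leq_sigma a jB; lia.
have u0 j : j \notin B -> j != o -> u j = 0%N.
  move=> + jo; rewrite !inE jo mnmE /dexp /=; by case: ifP.
have lt_o j : j \in B -> (o < j)%N.
  rewrite !inE => /andP[jo jA]; have := omin j jA => /= le_oj.
  by rewrite ltn_neqAle le_oj andbT eq_sym.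
have -> : dyson_ct q a A = (dysonp q a (o |: B) * 'X_[0%MM])@_u.
  by rewrite /dyson_ct mpolyX0 mulr1 -AE.
rewrite (elimination oB lt_o uB u0); last by rewrite mdeg0 addn0 -AE.
rewrite mpolyX0 mulr1 (dyson_poly _ _ _).1 IHB sAE [X in _ = _ / X](big_setD1 o) //= -/B.
have -> : \prod_(r < sigma a B) ((1 - q ^+ a o * q ^+ r.+1) / (1 - q ^+ r.+1)) =
    qfact q (a o + sigma a B) / (qfact q (a o) * qfact q (sigma a B)).
  rewrite qfactD invfM mulrACA divff ?qfact_neq0 // mul1r qfactE -prodfV -big_split /=.
  by apply: eq_bigr => r _; rewrite -exprD addnS.
have nz : \prod_(i in B) qfact q (a i) != 0 by apply/prodf_neq0 => i _; exact: qfact_neq0.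
by field; rewrite nz !qfact_neq0.
Qed.

End Elim.

(** * Marked variables *)
Section Marked.
Variables (K : fieldType) (q : K).
Variables (n : nat) (a : 'I_n.+1 -> nat).
Local Notation N := n.+1.
Local Notation mp := {mpoly K[N]}.
Implicit Types (A B I S T : {set 'I_N}).

(** The sum over pairs s <= r in S, counted with those s >= r, is the square of
    the total plus the diagonal. *)
Lemma sum_tight S : (2 * \sum_(s in S) a s * tight a S s =
  2 * sigma a S + sigma a S ^ 2 + \sum_(s in S) a s ^ 2)%N.
Proof.
pose above := (\sum_(s in S) \sum_(r in S | (s <= r)%N) a s * a r)%N.
have -> : (\sum_(s in S) a s * tight a S s = sigma a S + above)%N.
  rewrite /sigma /above -big_split; apply: eq_bigr => s _ /=.
  by rewrite mulnS big_distrr.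
have : (above = \sum_(s in S) \sum_(r in S | (r <= s)%N) a s * a r)%N.
  rewrite /above (exchange_big_dep (mem S)) /= => [|s r _ /andP[]//].
  apply: eq_bigr => s sS; apply: eq_big => r; rewrite ?sS // => _; exact: mulnC.
have : (sigma a S ^ 2 + \sum_(s in S) a s ^ 2 =
   above + \sum_(s in S) \sum_(r in S | (r <= s)%N) a s * a r)%N.
  rewrite -mulnn {1}/sigma big_distrl -big_split /above -big_split /=.
  apply: eq_bigr => s sS; rewrite big_distrr /=.
  rewrite !big_mkcondr -big_split /= (bigD1 s) //= [in RHS](bigD1 s) //= leqnn.
  rewrite -mulnn [LHS]addnAC; congr (_ + _)%N; apply: eq_bigr => r /andP[_].
  by rewrite -val_eqE /=; case: ltngtP; rewrite ?addn0.
lia.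
Qed.

Hypothesis q0 : q != 0.

(** The lowest terms contributed by one t in T collapse to minus the reciprocal
    of the coordinate that t would have at the tight point of S. This makes the
    formula uniform in T. *)
Lemma edge_product S (t : 'I_N) : t \notin S ->
  csign q (sigma a S).+1 *
    \prod_(s in S) \prod_(r < a s) (- (q ^+ (r + (t < s)) * q ^- tight a S s)) =
  - q ^+ tight a S t.
Proof.
move=> tS; pose tri := (\sum_(s in S) 'C(a s, 2))%N.
have -> : \prod_(s in S) \prod_(r < a s) (- (q ^+ (r + (t < s)) * q ^- tight a S s)) =
    (-1) ^+ sigma a S * q ^+ (tri + \sum_(r in S | (t <= r)%N) a r) /
      q ^+ (\sum_(s in S) a s * tight a S s).
  rewrite big_mkcondr -big_split /= /sigma !expr_sum -prodfV -!big_split /=.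
  apply: eq_bigr => s sS.
  have -> : \prod_(r < a s) (- (q ^+ (r + (t < s)) * q ^- tight a S s)) =
      \prod_(r < a s) (-1 * q ^+ r * q ^+ (t < s) / q ^+ tight a S s).
    by apply: eq_bigr => r _; rewrite exprD !mulN1r !mulNr.
  rewrite !big_split /= !prodr_const card_ord prodrXr exprVn -!exprM.
  have -> : (\sum_(r < a s) r = 'C(a s, 2))%N by rewrite -bin2_sum big_mkord.
  have -> : (t <= s)%N = (t < s)%N.
    by rewrite leq_eqVlt; case: eqP => // /val_inj ts; rewrite ts sS in tS.
  rewrite exprD mulrA [(tight _ _ _ * _)%N]mulnC; congr (_ * _ / _).
  by case: (t < s)%N; rewrite ?mul1n ?mul0n ?muln1 ?muln0.
(* the exponents of q balance by the quadratic identity sum_tight *)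
have key : ('C((sigma a S).+2, 2) + tri = (\sum_(s in S) a s * tight a S s).+1)%N.
  have := sum_tight S; have := tri2 (sigma a S).+1.
  have : (2 * tri + sigma a S = \sum_(s in S) a s ^ 2)%N.
    rewrite /tri big_distrr /sigma -big_split; apply: eq_bigr => s _ /=.
    by case: (a s) => [|k]; rewrite // [(2 * _)%N]mulnC tri2; lia.
  by move: (\sum_(s in S) a s ^ 2)%N (\sum_(s in S) a s * tight a S s)%N; nia.
have -> : csign q (sigma a S).+1 = - (-1) ^+ sigma a S * q ^+ 'C((sigma a S).+2, 2).
  by rewrite /csign exprS mulN1r.
rewrite /tight; set above := (\sum_(r in S | (t <= r)%N) a r)%N.
rewrite -/(tight a S _); move: key.
set X := (\sum_(s in S) a s * tight a S s)%N; move=> key.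
have sg2 : ((-1) ^+ sigma a S : K) * (-1) ^+ sigma a S = 1 by rewrite -expr2 sqrr_sign.
transitivity (- ((-1) ^+ sigma a S * (-1) ^+ sigma a S) *
   (q ^+ ('C((sigma a S).+2, 2) + tri) * q ^+ above / q ^+ X)).
  by rewrite (exprD q 'C(_, _)) (exprD q tri); field; rewrite expf_neq0.
by rewrite sg2 key -exprD addSn -addnS addnC exprD mulfK ?expf_neq0 // mulN1r.
Qed.

(** By edge_product a term is, up to sign, a product of two constants
    depending on A :\: T and T, times the value of x^p / prod_(i in I) x_i at
    the tight point, with the variables of T inserted with weight 0. *)
Lemma nodeterm_simpl A I (p : 'X_{1..N}) c0 T h : admissible a A I p h T -> I \subset A ->
    (forall i, i \notin A -> p i = 0%N) ->
  nodeterm q a A I p c0 T = (-1) ^+ #|T| * (tight_residue q a (A :\: T) * dyson_ct q a T) *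
    (\prod_(i in I) q ^+ tight a (A :\: T) i) /
    \prod_(i in A) q ^+ (tight a (A :\: T) i * p i).
Proof.
case/and4P=> sTA sTI /forall_inP p0 _ sIA p_supp; rewrite /nodeterm.
set S := A :\: T; set s := tight a S; set h' := (sigma a S).+1.
have inS i : i \in S -> (i \in A) /\ (i \notin T) by rewrite inE => /andP[].
have dST : [disjoint S & T].
  by rewrite disjoints_subset; apply/subsetP => i; rewrite !inE => /andP[].
have -> : (dysonp q a S).@[node_point q A c0 s] = (dysonp q a S).@[fun i => q ^- s i].
  by apply: eq_dysonp_eval => i /inS[iA _]; rewrite /node_point iA.
have -> : \prod_(i in S) node_weight q a A I h' s i =
    (\prod_(i in S) (pole_weight q (a i) h' (s i) * q ^+ (s i * (sigma a S - a i)))) *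
    (\prod_(i in S) q ^+ (s i * sigma a T)) * \prod_(i in I :\: T) q ^+ s i.
  have -> : \prod_(i in I :\: T) q ^+ s i = \prod_(i in S) q ^+ (s i * (i \in I)).
    rewrite [RHS](bigID (mem I)) /= [X in _ * X]big1 ?mulr1.
      apply: eq_big => i; last by move=> /[!inE] /andP[_ ->]; rewrite muln1.
      rewrite /S !inE -andbA; congr (_ && _).
      by case: (boolP (i \in I)) => iI; rewrite ?andbF ?(subsetP sIA).
    by move=> i /andP[_ /negbTE ->]; rewrite muln0.
  rewrite -!big_split /=; apply: eq_bigr => i iS; have [iA iT] := inS i iS.
  rewrite /node_weight iA -!mulrA -!exprD -!mulnDr /shift (sigmaU a sTA) -/S.
  congr (_ * q ^+ (_ * _)); rewrite addnA; congr (_ + _)%N.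
  by have := leq_sigma a iS; lia.
have -> : \prod_(i in S) node_point q A c0 s i ^+ p i = (\prod_(i in A) q ^+ (s i * p i))^-1.
  rewrite [in RHS](big_setID T) /= (setIidPr sTA) [X in X * _]big1 ?mul1r => [|i iT]; last first.
    by rewrite (eqP (p0 i iT)) muln0.
  rewrite -prodfV; apply: eq_bigr => i /inS[iA _].
  by rewrite /node_point iA exprVn exprM.
rewrite -[dyson_ct q a T * _ * _]mulrA.
have -> : (cross q a S T (node_point q A c0 s))@_0%MM * csign q h' ^+ #|T| =
    (\prod_(t in T) - q ^+ s t) / \prod_(i in S) q ^+ (s i * sigma a T).
  rewrite cross0 // -prodr_const exchange_big /= -big_split /= -prodfV.
  have -> : \prod_(i in S) (q ^+ (s i * sigma a T))^-1 =
     \prod_(t in T) \prod_(i in S) (q ^- s i) ^+ a t.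
    rewrite exchange_big; apply: eq_bigr => i _ /=.
    by rewrite prodrXr exprVn exprM.
  rewrite -big_split; apply: eq_bigr => t tT /=.
  have tS : t \notin S by rewrite (disjointFl dST).
  rewrite -edge_product // -[RHS]mulrA -big_split mulrC; congr (_ * _).
  apply: eq_bigr => i /inS[iA _] /=; rewrite /node_point iA; congr (_ * _).
rewrite [\prod_(i in I) _](big_setID T) /= (setIidPr sTI).
have -> : \prod_(t in T) - q ^+ s t = (-1) ^+ #|T| * \prod_(t in T) q ^+ s t.
  rewrite -prodr_const -big_split; apply: eq_bigr => t _ /=.
  by rewrite mulN1r.
rewrite /tight_residue -/s -/h'; field.
by apply/andP; split; apply/prodf_neq0 => i _; exact: expf_neq0.
Qed.

Hypothesis q1 : forall k, (0 < k)%N -> q ^+ k != 1.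

(** The Lagrange polynomial of the node q^-h among q^0, ..., q^-(s+1). *)
Definition lagrange s h z : K :=
  \prod_(k < s.+2 | k != h :> nat) ((1 - z * q ^+ k) / (1 - q ^+ k / q ^+ h)).

(** The monomial x^p / prod_(i in I) x_i has degree 1, which raises the degree
    in z by one, so sigma a A + 2 nodes are needed. The value at z = 1 is 0 for reasons of
    degree, the others come from node_value; T belongs to the node with
    h = sigma a (A :\: T) + 1. *)
Lemma marked_value A I (p : 'X_{1..N}) c0 z : I \subset A ->
    (forall i, i \notin A -> p i = 0%N) -> (forall i, i \in I -> p i = 0%N) ->
    mdeg p = #|I|.+1 ->
  tens (elimfun q a A I c0 z) (dysonp q a A * 'X_[p]) =
  \sum_(T : {set 'I_N} | T \subset I)
     nodeterm q a A I p c0 T * lagrange (sigma a A) (sigma a (A :\: T)).+1 z.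
Proof.
move=> sIA p_supp pI dp; set s := sigma a A.
have homG : homogeneous (\sum_j dexp a A j + mdeg p)%N (dysonp q a A * 'X_[p]).
  by apply: homogeneousM; [exact: homogeneous_dysonp | exact: homogeneousX].
have sum_shift : (\sum_(i in A) shift a A I i = \sum_(i in A) (s - a i) + #|I|)%N.
  rewrite big_split /=; congr (_ + _)%N.
  rewrite (big_setID I) /= (setIidPr sIA) [X in (_ + X)%N]big1 ?addn0.
    by rewrite -sum1_card; apply: eq_bigr => i ->.
  by move=> i; rewrite inE => /andP[/negbTE->].
have le_d : (\sum_j dexp a A j + mdeg p + sigma a A
     <= s.+1 + \sum_(i in A) shift a A I i)%N.
  rewrite sum_shift sum_dexp dp -/s; lia.
have [L sL LE] := elim_poly q c0 homG le_d.
pose lagP h : {poly K} := \prod_(k < s.+2 | k != h :> nat)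
   ((1 - q ^+ k / q ^+ h)^-1 *: (1 - q ^+ k *: 'X)).
have lagPE h z' : (lagP h).[z'] = lagrange s h z'.
  rewrite horner_prod; apply: eq_bigr => k _.
  by rewrite hornerZ hornerD hornerN hornerZ hornerX hornerC mulrC [z' * _]mulrC.
have hT_bd T : ((sigma a (A :\: T)).+1 < s.+2)%N.
  by rewrite !ltnS /s /sigma [leqRHS](big_setID T) /= leq_addl.
pose M := \sum_(T : {set 'I_N} | T \subset I)
     nodeterm q a A I p c0 T *: lagP (sigma a (A :\: T)).+1.
have ME z' : M.[z'] = \sum_(T : {set 'I_N} | T \subset I)
     nodeterm q a A I p c0 T * lagrange s (sigma a (A :\: T)).+1 z'.
  by rewrite horner_sum; apply: eq_bigr => T _; rewrite hornerZ lagPE.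
suff LM : L = M by rewrite -LE LM ME.
apply: (eq_poly_nodes q0 q1 sL).
- rewrite /M; apply: (big_ind (fun L : {poly K} => (size L <= s.+2)%N)).
  + by rewrite size_poly0.
  + move=> L1 L2 s1 s2; apply: leq_trans (size_polyD _ _) _.
    by rewrite geq_max s1.
  move=> T _; apply: leq_trans (size_scale_leq _ _) _.
  set h := (sigma _ _).+1.
  have [-> | nz] := eqVneq (lagP h) 0; first by rewrite size_poly0.
  apply: leq_trans (size_poly_prod_leq _ _) _.
  rewrite leq_subLR addnC.
  have c : #|[pred k : 'I_s.+2 | k != h :> nat]| = s.+1.
    transitivity #|predC1 (Ordinal (hT_bd T))|; last by rewrite cardC1 card_ord.
    by apply: eq_card => k; rewrite !inE; apply/idP/idP.
  have : (\sum_(k < s.+2 | k != h :> nat)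
      size ((1 - q ^+ k / q ^+ h)^-1 *: (1 - q ^+ k *: 'X : {poly K}))%R
      <= \sum_(k < s.+2 | k != h :> nat) 2)%N.
    apply: leq_sum => k _.
    rewrite (leq_trans (size_scale_leq _ _)) // (leq_trans (size_polyD _ _)) //.
    rewrite geq_max size_poly1 size_polyN.
    by rewrite (leq_trans (size_scale_leq _ _)) // size_polyX.
  rewrite sum_nat_const c => /leq_ltn_trans; apply; lia.
case=> [|h] le_h; rewrite LE ME.
  have [v vE] : exists v : 'X_{1..N}, forall i, v i = if i \in A then shift a A I i else 0%N.
    by exists [multinom if i \in A then shift a A I i else 0%N | i < N] => i; rewrite mnmE.
  have dv : (mdeg v < mdeg [multinom dexp a A j | j < N] + mdeg p)%N.
    have -> : mdeg [multinom dexp a A j | j < N] = (\sum_(j in A) (s - a j))%N.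
      by rewrite mdegE -sum_dexp; apply: eq_bigr => j _; rewrite mnmE.
    by rewrite mdegE (eq_bigr _ (fun i _ => vE i)) -big_mkcond /= sum_shift dp addnS.
  rewrite expr0 invr1 (unit_value c0 q0 q1 p_supp vE (ltnW dv)) (ltn_eqF dv).
  rewrite big1 // => T _; rewrite /lagrange (bigD1 ord0) //=. rewrite expr0 [1 * 1]mul1r subrr.
  by rewrite !(mul0r, mulr0).
rewrite (node_value I c0 q0 q1 p_supp); last by rewrite ltnS.
rewrite [LHS]big_mkcond [RHS]big_mkcond; apply: eq_bigr => T _; rewrite /admissible.
case: (boolP (T \subset I)) => sTI; last by rewrite andbF.
rewrite (subset_trans sTI sIA) /=.
have -> : [forall t in T, p t == 0%N].
  by apply/forall_inP => t /(subsetP sTI)/pI->.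
case: eqP => [-> | neq] /=.
  rewrite /lagrange big1 ?mulr1 // => k neq_k; rewrite [q ^- _ * _]mulrC divff //.
  rewrite subr_eq0; apply: contra neq_k => /eqP.
  move/(congr1 (fun x => x * q ^+ h.+1)); rewrite mul1r divfK ?expf_neq0 //.
  by move/(expf_inj q0 q1)->.
have lt_h : (h.+1 < s.+2)%N by [].
rewrite /lagrange (bigD1 (Ordinal lt_h)) /=; last by apply/eqP; apply/nesym.
by rewrite mulVf ?expf_neq0 // subrr !(mul0r, mulr0).
Qed.

End Marked.

(** * The constant term formula for coefficients *)
Section Assembly.
Variables (K : fieldType) (q : K).
Hypotheses (q0 : q != 0) (q1 : forall k, (0 < k)%N -> q ^+ k != 1).
Variables (n : nat) (a : 'I_n.+1 -> nat).
Local Notation N := n.+1.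
Local Notation mp := {mpoly K[N]}.
Implicit Types (A B I S T : {set 'I_N}).

Lemma prod_ord_skip (F : nat -> K) h m :
  \prod_(k < (h + m).+1 | k != h :> nat) F k =
  \prod_(k < h) F k * \prod_(k < m) F (h + k).+1.
Proof.
rewrite big_mkcond -addnS big_split_ord /= [X in _ * X]big_ord_recl /= addn0 eqxx mul1r.
congr (_ * _); apply: eq_bigr => k _; first by rewrite ltn_eqF.
by rewrite /bump add1n addnS gtn_eqF // ltnS leq_addr.
Qed.

Lemma lagrange_denominator h m : \prod_(k < (h + m).+1 | k != h :> nat) (1 - q ^+ k / q ^+ h) =
  (-1) ^+ h * qfact q h / q ^+ 'C(h.+1, 2) * qfact q m.
Proof.
rewrite (prod_ord_skip (fun k => 1 - q ^+ k / q ^+ h)) -qfactV //; congr (_ * _).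
  rewrite [RHS](reindex_inj rev_ord_inj) /=; apply: eq_bigr => i _.
  have -> : q ^+ h = q ^+ (h - i.+1).+1 * q ^+ i by rewrite -exprD subnSK // subnK // ltnW.
  by congr (_ - _); field; rewrite !expf_neq0.
rewrite qfactE; apply: eq_bigr => i _; rewrite -addnS exprD [q ^+ h * _]mulrC.
by rewrite mulfK ?expf_neq0.
Qed.

(** Both constants in nodeterm_simpl are known, from dyson_poly and q_dyson;
    here they are combined with the Lagrange polynomial at z = q^b. *)
Lemma lagrange_residue A T b (s := sigma a A) (h := (sigma a (A :\: T)).+1) : T \subset A ->
  tight_residue q a (A :\: T) * dyson_ct q a T * lagrange q s h (q ^+ b) =
  - (qfact q (b + s) / (qfact q b * \prod_(i in A) qfact q (a i))) * q ^+ h *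
   ((1 - q ^+ b) * (1 - q ^+ (b + s).+1) / ((1 - q ^+ h) * (1 - q ^+ (b + h)))).
Proof.
move=> sTA; rewrite (dyson_poly a q0 q1 (A :\: T) (fun=> 0) 0).2 !q_dyson //.
rewrite [\prod_(i in A) _](big_setID T) /= (setIidPr sTA).
have sE : s = (sigma a (A :\: T) + sigma a T)%N by rewrite /s (sigmaU a sTA) addnC.
have hm : s.+2 = (h + sigma a T).+1 by rewrite sE.
rewrite /lagrange big_split /= prodfV hm lagrange_denominator.
have hb : (b + h = (b + sigma a (A :\: T)).+1)%N by rewrite /h addnS.
have F0 k : 1 - q ^+ k.+1 != 0 by apply: subqX_neq0.
have num : (\prod_(k < (h + sigma a T).+1 | k != h :> nat) (1 - q ^+ b * q ^+ k)) =
   (1 - q ^+ b) * (qfact q (b + s) / qfact q b) * (1 - q ^+ (b + s).+1) /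
     (1 - q ^+ (b + h)).
  have lt_h : (h < (h + sigma a T).+1)%N by rewrite ltnS leq_addr.
  apply: (mulfI (F0 (b + sigma a (A :\: T))%N)).
  transitivity (\prod_(k < (h + sigma a T).+1) (1 - q ^+ b * q ^+ k)).
    by rewrite [RHS](bigD1 (Ordinal lt_h)) //= -exprD hb.
  rewrite -hm big_ord_recl big_ord_recr /= expr0 mulr1 qfactD.
  have -> : \prod_(i < s) (1 - q ^+ b * q ^+ bump 0 i) = \prod_(r < s) (1 - q ^+ (b + r).+1).
    by apply: eq_bigr => r _; rewrite -exprD /bump add1n addnS.
  rewrite /bump add1n -exprD addnS hb; field.
  by rewrite F0 qfact_neq0.
rewrite num hb qfactS.
have P0 B : \prod_(i in B) qfact q (a i) != 0.
  by apply/prodf_neq0 => i _; exact: qfact_neq0.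
have sg : (-1) ^+ h = - (-1) ^+ sigma a (A :\: T) :> K by rewrite /h exprS mulN1r.
have C2 : q ^+ 'C(h.+1, 2) = q ^+ 'C((sigma a (A :\: T)).+1, 2) * q ^+ h.
  by rewrite -exprD [in LHS](binS h 1) bin1.
rewrite sg C2; have nzsg : (-1) ^+ sigma a (A :\: T) != 0 :> K by rewrite signr_eq0.
have := F0 (sigma a (A :\: T)); rewrite -/h => F1.
have := F0 (b + sigma a (A :\: T))%N => F2.
by field; rewrite ?P0 ?qfact_neq0 ?expf_neq0 ?F1 ?F2 ?oppr_eq0 ?nzsg.
Qed.

Local Notation A0 := [set~ (ord0 : 'I_N)].

Lemma sum_wt T (l : 'I_N) : l != ord0 ->
  (\sum_(r < N | (l <= r)%N) wt a T r).+1 = tight a (A0 :\: T) l.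
Proof.
move=> l0; rewrite /tight; congr _.+1; rewrite [LHS]big_mkcond [RHS]big_mkcond.
apply: eq_bigr => r _; rewrite !inE /wt; case: leqP => lr; last by rewrite andbF.
have -> : r != ord0 by move: l0 lr; rewrite -!val_eqE /= -!lt0n; apply: leq_trans.
by case: (r \in T).
Qed.

Lemma sum_wt0 T : \sum_(r < N | ((ord0 : 'I_N) <= r)%N) wt a T r =
  ((if ord0 \in T then 0 else a ord0) + sigma a (A0 :\: T))%N.
Proof.
rewrite (bigD1 ord0) //= {1}/wt; congr (_ + _)%N; rewrite /sigma.
rewrite [LHS]big_mkcond [RHS]big_mkcond; apply: eq_bigr => r _.
by rewrite !inE /wt; case: (r == ord0); case: (r \in T).
Qed.

Definition wtsum T l : nat := (\sum_(r < N | (l <= r)%N) wt a T r)%N.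

Definition summand (I : {set 'I_N}) (p : 'X_{1..N}) T : K :=
  (-1) ^+ #|T| *
  (q ^+ (\sum_(l in I) wtsum T l) / q ^+ (\sum_l p l * wtsum T l)) *
  ((1 - q ^+ sigma a T) / (1 - q ^+ (1 + a ord0 + sigma a A0 - sigma a T))).

(** The subsets with and without the index ord0 are paired because the terms of
    T and ord0 |: T come from the same Lagrange term. *)
Lemma sum_pairs (F : {set 'I_N} -> K) I : ord0 \notin I -> F set0 = 0 ->
  \sum_(T : {set 'I_N} | (T != set0) && (T \subset ord0 |: I)) F T =
  \sum_(T : {set 'I_N} | T \subset I) (F T + F (ord0 |: T)).
Proof.
move=> oI F0; rewrite big_split /= (bigID (fun T : {set 'I_N} => ord0 \in T)) /= addrC.
have subI T : ord0 \notin T -> (T \subset ord0 |: I) = (T \subset I).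
  move=> oT; apply/subsetP/subsetP => sTI i iT; last by rewrite !inE sTI ?orbT.
  by have := sTI i iT; rewrite !inE; case: eqP iT oT => // -> ->.
congr (_ + _).
  rewrite [RHS](bigID (fun T : {set 'I_N} => T == set0)) /=.
  rewrite [X in _ = X + _](_ : _ = 0) ?add0r; last by rewrite big1 // => T /andP[_ /eqP->].
  apply: eq_bigl => T; rewrite -andbA andbC; case: (boolP (ord0 \in T)) => oT /=.
    rewrite andbF; apply/esym/negbTE; apply/negP => /andP[/subsetP/(_ _ oT)].
    by rewrite (negbTE oI).
  by rewrite andbT subI.
rewrite (reindex_onto (fun T => ord0 |: T) (fun T => T :\ ord0)) /=; last first.
  by move=> T /andP[_ oT]; rewrite setD1K.
apply: eq_bigl => T; rewrite setU11 andbT.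
have -> : ord0 |: T != set0 by apply/set0Pn; exists ord0; rewrite setU11.
rewrite /= -[_ == T]/(_ == T); apply/andP/idP => [[sT /eqP TE] | sTI].
  have oT : ord0 \notin T by rewrite -TE !inE eqxx.
  by rewrite -subI //; apply: subset_trans sT; rewrite subsetUr.
have oT : ord0 \notin T by apply: contra oI => /(subsetP sTI).
by rewrite setUS // setU1K.
Qed.

(** By marked_value the coefficient is a sum over T contained in I. Writing h for
    sigma a (A :\: T) + 1 and b for a_0, each term splits in two by
    q^b (1 - q^sigma) (1 - q^h) - (1 - q^(b + sigma)) (1 - q^(b + h))
    = - (1 - q^b) (1 - q^(b + h + sigma)), where sigma is sigma a T. *)
Theorem marked_coeff I (p u : 'X_{1..N}) : ord0 \notin I -> p ord0 = 0%N ->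
    (forall i, i \in I -> p i = 0%N) -> mdeg p = #|I|.+1 ->
    (forall i, u i = dexp a setT i + (i \in ord0 |: I))%N ->
  (dysonp q a setT * 'X_[p])@_u =
   qfact q (sigma a A0 + a ord0) / (\prod_k qfact q (a k)) *
   \sum_(T : {set 'I_N} | (T != set0) && (T \subset ord0 |: I)) summand (ord0 |: I) p T.
Proof.
move=> oI p_o pI dp uE; have oA : ord0 \notin A0 by rewrite !inE eqxx.
have AT : ord0 |: A0 = setT by apply/setP => i; rewrite !inE orbN.
have sIA : I \subset A0 by rewrite subsetC sub1set inE.
have p_supp i : i \notin A0 -> p i = 0%N by rewrite !inE negbK => /eqP->.
have sT : sigma a setT = (a ord0 + sigma a A0)%N.
  by rewrite (sigmaD1 a (in_setT ord0)) setTD.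
rewrite -AT (@elimination _ _ _ _ q0 q1 _ I _ _ _ oA); first last.
- rewrite AT dp mdegE (eq_bigr _ (fun i _ => uE i)) big_split /= mdegE.
  congr (_ + _)%N; first by apply: eq_bigr => i _; rewrite mnmE.
  by rewrite -big_mkcond sum1_card cardsU1 oI.
- by move=> j; rewrite !inE negbK => ->.
- move=> j; rewrite !inE => j0; rewrite uE /dexp /shift inE sT !inE (negbTE j0) /=.
  have jA : j \in A0 by rewrite !inE.
  by rewrite -addnBA ?(leq_sigma a jA) // [RHS]addnC addnA.
- by move=> j; rewrite !inE -val_eqE lt0n.
rewrite (marked_value a q0 q1 _ _ sIA p_supp pI dp) sum_pairs // /summand; last first.
  by rewrite /sigma big_set0 expr0 subrr mul0r mulr0.
rewrite mulr_sumr; apply: eq_bigr => T sTI; rewrite -/(summand _ _ _).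
have sTA := subset_trans sTI sIA; have oT : ord0 \notin T.
  by apply: contra oI => /(subsetP sTI).
set S := A0 :\: T; set s := sigma a A0; set b := a ord0.
have sE : s = (sigma a S + sigma a T)%N by rewrite /s (sigmaU a sTA) addnC.
have gT : admissible a A0 I p (sigma a S).+1 T.
  rewrite /admissible sTA sTI eqxx andbT; apply/forall_inP => t tT.
  by rewrite pI ?(subsetP sTI).
rewrite (nodeterm_simpl q0 _ gT sIA p_supp) -/S.
pose W (l : 'I_N) := (tight a S l).-1.
have WE T' l : l != ord0 -> A0 :\: T' = S -> wtsum T' l = W l.
  by move=> l0 eqS; rewrite /W -eqS -sum_wt.
have SU : A0 :\: (ord0 |: T) = S.
  by apply/setP => i; rewrite !inE negb_or; case: (i == ord0); rewrite ?andbF ?andbT.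
have sumI T' : A0 :\: T' = S -> (\sum_(l in ord0 |: I) wtsum T' l =
    (if ord0 \in T' then 0 else b) + sigma a S + \sum_(l in I) W l)%N.
  move=> eqS; rewrite big_setU1 //= {1}/wtsum sum_wt0 eqS; congr (_ + _)%N.
  by apply: eq_bigr => l lI; apply: WE => //; apply: contraNneq oI => <-.
have sump T' : A0 :\: T' = S -> (\sum_l p l * wtsum T' l = \sum_l p l * W l)%N.
  move=> eqS; apply: eq_bigr => l _; have [-> | l0] := eqVneq l ord0.
    by rewrite p_o !mul0n.
  by rewrite WE.
rewrite /summand !sumI // !sump // setU11 (negbTE oT) cardsU1 oT.
have sU : sigma a (ord0 |: T) = (b + sigma a T)%N by rewrite /sigma big_setU1.
rewrite sU.
have -> : (1 + b + s - sigma a T = b + (sigma a S).+1)%N by rewrite sE; lia.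
have -> : (1 + b + s - (b + sigma a T) = (sigma a S).+1)%N by rewrite sE; lia.
have tW l : tight a S l = (W l).+1 by [].
have -> : \prod_(i in I) q ^+ tight a S i = q ^+ (\sum_(l in I) W l) * q ^+ #|I|.
  rewrite prodrXr -exprD; congr (_ ^+ _); rewrite -sum1_card -big_split /=.
  by apply: eq_bigr => l _; rewrite tW addn1.
have -> : \prod_(i in A0) q ^+ (tight a S i * p i) =
    q ^+ (\sum_l p l * W l) * q ^+ #|I|.+1.
  rewrite prodrXr -exprD -dp mdegE -big_split /=; congr (_ ^+ _).
  rewrite big_mkcond; apply: eq_bigr => l _; case: ifPn => lA.
    by rewrite tW mulnC mulnS addnC.
  by rewrite p_supp.
set Z := q ^+ (\sum_(l in I) W l)%N; set V := q ^+ (\sum_l p l * W l)%N.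
have nzZ : Z != 0 by exact: expf_neq0.
have nzV : V != 0 by exact: expf_neq0.
transitivity (((-1) ^+ #|T| * (Z / V / q)) *
    (tight_residue q a S * dyson_ct q a T * lagrange q s (sigma a S).+1 (q ^+ b))).
  by rewrite exprS; field; rewrite nzV q0 expf_neq0.
rewrite (lagrange_residue _ sTA) -/S -/s.
have -> : \prod_k qfact q (a k) = qfact q b * \prod_(i in A0) qfact q (a i).
  by rewrite (bigD1 ord0) //=; congr (_ * _); apply: eq_bigl => i; rewrite !inE.
rewrite [(s + b)%N]addnC.
have F0 k : 1 - q ^+ k.+1 != 0 by apply: subqX_neq0.
have := F0 (sigma a S); have := F0 (b + sigma a S)%N; rewrite -addnS.
have P0 : \prod_(i in A0) qfact q (a i) != 0.
  by apply/prodf_neq0 => i _; exact: qfact_neq0.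
have -> : (b + s).+1 = (b + (sigma a S).+1 + sigma a T)%N by rewrite sE; lia.
rewrite -/Z -/V !add0n !(exprD q b) !(exprD q (sigma a S)) !(exprD q (b + _)).
rewrite !(exprD q b) exprS add1n exprS mulN1r.
move=> F1 F2.
rewrite -/Z; field.
by rewrite ?P0 ?qfact_neq0 ?nzV ?q0 ?F1 ?F2.
Qed.

End Assembly.

(** * Laurent polynomials as fractions *)
Lemma pairprod_ltn (R : comNzRingType) n (f : 'I_n -> 'I_n -> R) :
  \prod_(i < n) \prod_(j < n | (i < j)%N) (f i j * f j i) = pairprod f setT.
Proof.
rewrite /pairprod; under [LHS]eq_bigr do rewrite big_split; rewrite [LHS]big_split /=.
rewrite [X in _ * X](exchange_big_dep xpredT) //= -big_split.
apply: eq_big => [i|i _]; first by rewrite inE.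
rewrite [RHS](bigID (fun j : 'I_n => (i < j)%N)) /=; congr (_ * _); apply: eq_bigl => j.
  by rewrite inE -val_eqE /=; case: ltngtP.
by rewrite inE -val_eqE /=; case: ltngtP.
Qed.

Lemma one_sub_div (F : fieldType) (z y c : F) : y != 0 -> 1 - z / y * c = (y - c * z) / y.
Proof. by move=> y0; field. Qed.

Section Bridge.
Variables (K : fieldType) (q : K) (n : nat) (a : 'I_n.+1 -> nat).
Local Notation N := n.+1.
Local Notation mp := {mpoly K[N]}.
Local Notation x := (@rvar K N).

Lemma rvar_neq0 i : x i != 0.
Proof.
rewrite tofrac_eq0; apply/eqP => /(congr1 (mcoeff U_(i)%MM))/eqP.
by rewrite mcoeffX eqxx mcoeff0 oner_eq0.
Qed.

Lemma pfac_frac i j : (pfac q a i j)%:Frac =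
  \prod_(r < a i) (x j - rconst N q ^+ (r + (j < i)) * x i).
Proof.
rewrite /pfac rmorph_prod; apply: eq_bigr => r _.
by rewrite rmorphB /= -mul_mpolyC rmorphM rmorphXn /= rmorphXn.
Qed.

Lemma dyson_frac : dyson q a =
  (dysonp q a setT)%:Frac / ('X_[[multinom dexp a setT j | j < N]] : mp)%:Frac.
Proof.
pose f i j : ratfun K N := (pfac q a i j)%:Frac / x j ^+ a i.
have -> : dyson q a = pairprod f setT.
  rewrite -pairprod_ltn; apply: eq_bigr => i _; apply: eq_bigr => j lt_ij.
  have powE (y : ratfun K N) k : y ^+ k = \prod_(r < k) y by rewrite prodr_const card_ord.
  rewrite /f !pfac_frac !powE -!prodfV -!big_split /qpoch; congr (_ * _).
    apply: eq_bigr => r _; rewrite one_sub_div ?rvar_neq0 // ltnNge ltnW //= addn0.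
    by [].
  apply: eq_bigr => r _; rewrite -(mulrA (x j / x i)) -exprS one_sub_div ?rvar_neq0 // lt_ij addn1.
  by [].
have -> : (dysonp q a setT)%:Frac = pairprod (fun i j => (pfac q a i j)%:Frac) setT.
  rewrite /dysonp /pairprod rmorph_prod; apply: eq_bigr => i _.
  by rewrite rmorph_prod.
rewrite /pairprod /f; under eq_bigr do rewrite big_split /= prodfV.
rewrite big_split /= prodfV; congr (_ / _).
rewrite (exchange_big_dep xpredT) //= mpolyXE_id rmorph_prod; apply: eq_bigr => j _.
rewrite rmorphXn /= mnmE /dexp inE prodrXr; congr (_ ^+ _).
rewrite /sigma [in RHS](bigD1 j) ?inE //= addKn; apply: eq_bigl => i.
by rewrite !inE eq_sym.
Qed.

End Bridge.

Lemma qind_neq0 (R : realType) : qind R != 0.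
Proof. by rewrite tofrac_eq0 polyX_eq0. Qed.

Lemma qind_expf_neq1 (R : realType) k : (0 < k)%N -> qind R ^+ k != 1.
Proof.
move=> k_gt0; rewrite /qind -tofracXn -tofrac1 tofrac_eq.
apply/eqP => /(congr1 (fun s : {poly _} => size s)).
by rewrite size_polyXn size_poly1 => -[k0]; rewrite k0 in k_gt0.
Qed.

Theorem theorem1p3 (R : realType) (n : nat) (n_ge1 : (1 <= n)%N)
    (a : 'I_n.+1 -> nat)
    (m nu : nat) (m_gt0 : (0 < m)%N)
    (i : 'I_m -> 'I_n.+1) (j : 'I_nu -> 'I_n.+1) (p : 'I_nu -> nat)
    (i_first : i (Ordinal m_gt0) = ord0)
    (i_incr : forall k l : 'I_m, (k < l)%N -> (i k < i l)%N)
    (i_ltn : forall k : 'I_m, (i k < n)%N)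
    (j_gt0 : forall l : 'I_nu, (0 < j l)%N)
    (j_incr : forall k l : 'I_nu, (k < l)%N -> (j k < j l)%N)
    (ij_distinct : forall (k : 'I_m) (l : 'I_nu), i k != j l)
    (p_gt0 : forall l : 'I_nu, (0 < p l)%N)
    (p_sum : (\sum_(l < nu) p l)%N = m) :
  let q : Cq R := qind R in
  let x := @rvar (Cq R) n.+1 in
  let a0 := a ord0 in
  let asum := (\sum_(k < n.+1 | (0 < k)%N) a k)%N in
  let I0 := [set i k | k : 'I_m] in
  CT ((\prod_(l < nu) x (j l) ^+ p l) / (\prod_(k < m) x (i k)) * dyson q a) =
  qfact q (asum + a0) / (\prod_(k < n.+1) qfact q (a k)) *
  \sum_(T : {set 'I_n.+1} | (T != set0) && (T \subset I0))
    ((-1) ^+ #|T| * q ^ Lexp a j p I0 T *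
     ((1 - q ^+ sigma a T) / (1 - q ^+ (1 + a0 + asum - sigma a T)))).
Proof.
move=> q x a0 asum I0.
have q0 : q != 0 := qind_neq0 R.
have q1 k : (0 < k)%N -> q ^+ k != 1 by apply: qind_expf_neq1.
have i_inj : injective i.
  move=> k l eq_ikl; apply/val_inj; case: (ltngtP k l) => //= /i_incr.
    by rewrite eq_ikl ltnn.
  by rewrite eq_ikl ltnn.
have oI0 : ord0 \in I0 by rewrite -i_first imset_f.
pose I := I0 :\ ord0.
have I0E : I0 = ord0 |: I by rewrite setD1K.
have oI : ord0 \notin I by rewrite !inE eqxx.
(* x^pm is the numerator; u clears the denominators of the Dyson product and of the x_(i_k) *)
pose pm := [multinom (\sum_(l < nu | j l == k) p l)%N | k < n.+1].
pose u := [multinom (dexp a setT k + (k \in I0))%N | k < n.+1].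
have XP : \prod_(l < nu) x (j l) ^+ p l = ('X_[pm] : {mpoly (Cq R)[n.+1]})%:Frac.
  rewrite mpolyXE_id rmorph_prod (partition_big j xpredT) //=; apply: eq_bigr => k _.
  rewrite rmorphXn /= mnmE -prodrXr; apply: eq_bigr => l /eqP <-.
  by [].
have XI : \prod_(k < m) x (i k) =
    ('X_[[multinom (k \in I0 : nat) | k < n.+1]] : {mpoly (Cq R)[n.+1]})%:Frac.
  rewrite mpolyXE_id rmorph_prod [RHS](bigID (mem I0)) /= [X in _ = _ * X]big1 ?mulr1.
    rewrite big_imset /=; last by move=> k l _ _; apply: i_inj.
    by apply: eq_big => // k _; rewrite mnmE imset_f // expr1.
  by move=> k /negbTE kI; rewrite mnmE kI expr0 rmorph1.
have uD : u = ([multinom (k \in I0 : nat) | k < n.+1] +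
               [multinom dexp a setT k | k < n.+1])%MM.
  by apply/mnmP => k; rewrite mnmDE !mnmE addnC.
rewrite XP XI dyson_frac mulrACA -invfM -!rmorphM /= -mpolyXD -uD CT_frac mulrC.
have pmE (F : 'I_n.+1 -> nat) : (\sum_k pm k * F k = \sum_(l < nu) p l * F (j l))%N.
  rewrite [RHS](partition_big j xpredT) //=; apply: eq_bigr => k _.
  by rewrite mnmE big_distrl; apply: eq_bigr => l /eqP ->.
have pm_eq0 k : (forall l, j l != k) -> pm k = 0%N.
  by move=> jk; rewrite mnmE big_pred0 // => l; apply/negbTE.
rewrite (@marked_coeff _ _ q0 q1 _ _ I); first last.
- by move=> k; rewrite mnmE -I0E.
- have := cardsD1 ord0 I0; rewrite oI0 -/I add1n => <-.
  rewrite card_imset // card_ord -p_sum mdegE.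
  have := pmE (fun=> 1%N); under eq_bigr do rewrite muln1.
  by under [in RHS]eq_bigr do rewrite muln1.
- move=> k; rewrite !inE => /andP[_ /imsetP[k' _ ->]]; apply: pm_eq0 => l.
  by rewrite eq_sym.
- apply: pm_eq0 => l; apply/eqP => jl; have := j_gt0 l; by rewrite jl.
- exact: oI.
have asumE : sigma a [set~ ord0] = asum.
  by apply: eq_bigl => k; rewrite !inE -val_eqE /= lt0n.
rewrite asumE -I0E; congr (_ * _); apply: eq_bigr => T _.
rewrite /summand asumE; congr (_ * _ * _).
by rewrite /Lexp expfzDr // exprnN -exprnP pmE.
Qed.
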